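(* For every integer $n\ge1$, the lattice $(\mathrm{NCCP}(n;312),\le)$ of $312$-avoiding noncommutative crossing partitions, with the order induced from $(\mathrm{NCCP}(n),\le)$, is isomorphic to the Kreweras lattice $(\mathrm{NCP}(n),\subseteq)$.
   Context: **Noncommutative crossing partitions.** Let $[n]=\{1,\dots,n\}$. A noncommutative crossing partition of $[n]$ is a finite sequence $\pi=(\pi_1,\dots,\pi_l)$, written $\pi_1/\cdots/\pi_l$, of nonempty blocks such that each $p\in[n]$ appears exactly once in $\pi$, each block is written as an increasing sequence, and $\max(\pi_i)>\min(\pi_{i+1})$ for $1\le i\le l-1$. $\mathrm{NCCP}(n)$ is the set of these. Concatenating the blocks gives a permutation of $[n]$ in one-line notation, which determines $\pi$ (slashes sit exactly at the descents); $\pi$ is identified with this permutation. $\mathrm{NCCP}(n;312)$ is the subset of those $\pi$ whose permutation avoids the pattern $312$. **Kreweras lattice.** $\mathrm{NCP}(n)$ is the set of $\pi=(\pi_1,\dots,\pi_l)\in\mathrm{NCCP}(n)$ that are non-crossing (there are no $a<b<c<d$ and $i\ne j$ with $a,c\in\pi_i$, $b,d\in\pi_j$) and canonical ($\min(\pi_l)<\min(\pi_{l-1})<\cdots<\min(\pi_1)$). The order $\subseteq$ is refinement: $\pi\subseteq\pi'$ iff every block of $\pi'$ is a union of blocks of $\pi$. **Labeled binary trees.** A labeled binary tree with $n$ nodes is a rooted tree in which each node has at most one left child and at most one right child, with nodes labeled bijectively by $[n]$ so that labels increase from the root to the leaves. Let $\phi(L)$ be the permutation (element of $\mathrm{NCCP}(n)$)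 obtained by reading the labels of $L$ in in-order (left subtree, root, right subtree). The map $\phi$ is a bijection from labeled binary trees with $n$ nodes to $\mathrm{NCCP}(n)$. **Rotation and cover relation.** Let $L$ be a labeled binary tree and let $\mathfrak n$ be a node that is the left child of its parent $\mathfrak n_0$. For a node $\mathfrak m$ let $p(\mathfrak m)$ be the set of nodes on the path from $\mathfrak m$ to the root, both included. Let $LS(\mathfrak n)$ be the set of nodes $\mathfrak m\in p(\mathfrak n)$, $\mathfrak m\neq\mathfrak n$, such that the child of $\mathfrak m$ lying on $p(\mathfrak n)$ is the left child of $\mathfrak m$. A node $\mathfrak n'$ with label smaller than that of $\mathfrak n$ is ''right to'' $\mathfrak n$ if there is a node $\mathfrak c$ with $\mathfrak n'$ in the right subtree of $\mathfrak c$ and $\mathfrak n$ in the left subtree of $\mathfrak c$. *Choice of $\mathfrak n_a$.* If no node with label smaller than that of $\mathfrak n$ is right to $\mathfrak n$, $\mathfrak n_a$ is any element of $LS(\mathfrak n)$. Otherwise let $\mathfrak n'_l$ be the left-most (in in-order) of the nodes of smaller label right to $\mathfrak n$, let $\mathfrak n_c$ be the node of maximal label in $p(\mathfrak n)\cap p(\mathfrak n'_l)$, and let $\mathfrak n_a$ be any element of $LS(\mathfrak n)\setminus(p(\mathfrak n_c)\setminus\{\mathfrak n_c\})$. *Choice of $S$.* Let $\mathfrak m_0=\mathfrak n$ and let $\mathfrak m_i$ be the left child of $\mathfrak m_{i-1}$ for $1\le i\le p$, with $p$ maximal. Let $S\subseteq\{1,\dots,p\}$ be any subset and $\mathfrak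 m(S)=\{\mathfrak m_i:i\in S\}$. *Two trees.* $T_1$: link the nodes of $\{\mathfrak n\}\cup\mathfrak m(S)$ by left edges in increasing label order (root $\mathfrak n$), each keeping its right subtree from $L$. $T_2$: link the nodes $\mathfrak n_0$ and $\mathfrak m_i$ ($1\le i\le p$, $i\notin S$) by left edges in increasing label order (root $\mathfrak n_0$), each keeping its right subtree from $L$, and replace in $L$ the subtree rooted at $\mathfrak n_0$ by this tree. *Gluing.* For a node $x$ let $\vec q(x)$ be the maximal chain $x$, right child of $x$, right child of that, etc. Take all nodes of $\vec q(\mathfrak n)$ in $T_1$ and of $\vec q(\mathfrak n_a)$ in $T_2$, sort them by increasing label (so $\mathfrak n_a$ is first), and link them successively by right edges; each of these nodes keeps its left subtree from $T_1$ or $T_2$. Replace the chain $\vec q(\mathfrak n_a)$ in $T_2$ by this chain, leaving the rest of $T_2$ unchanged. The resulting labeled binary tree $L'$ on $[n]$ is the rotation of $L$ with respect to the triplet $(\mathfrak n,\mathfrak n_a,\mathfrak m(S))$. For $\pi,\pi'\in\mathrm{NCCP}(n)$, $\pi\lessdot\pi'$ means that $\phi^{-1}(\pi')$ is a rotation of $\phi^{-1}(\pi)$ for some triplet, and $\pi\le\pi'$ means that there is a sequence $\pi=\pi_0\lessdot\pi_1\lessdot\cdots\lessdot\pi_m=\pi'$ with $m\ge0$. *)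

(* Defs.v *)
From mathcomp Require Export all_boot.
From Stdlib Require Export Relation_Operators.

Set Implicit Arguments.
Unset Strict Implicit.
Unset Printing Implicit Defensive.

Section Partitions.

Implicit Types (B C : seq nat) (pi : seq (seq nat)) (w : seq nat).

Definition block_max B : nat := \max_(x <- B) x.
Definition block_min B : nat := \big[minn/head 0 B]_(x <- B) x.

Definition is_nccp (n : nat) pi : bool :=
  [&& perm_eq (flatten pi) (iota 1 n),
      all (fun B => (B != [::]) && sorted ltn B) pi
    & sorted (fun B C => block_max B > block_min C) pi].

(* There are i < j < k with w_j < w_k < w_i. *)
Definition contains312 w : bool :=
  [exists i : 'I_(size w), exists j : 'I_(size w), exists k : 'I_(size w),
     (i < j < k) && (nth 0 w j < nth 0 w k < nth 0 w i)].

Definition crossing_blocks B C : bool :=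
  has (fun a => has (fun b => has (fun c => has (fun d =>
    [&& a < b, b < c & c < d]) C) B) C) B.

Definition noncrossing pi : bool :=
  [forall i : 'I_(size pi), forall j : 'I_(size pi),
     (i != j) ==> ~~ crossing_blocks (nth [::] pi i) (nth [::] pi j)].

Definition canonical pi : bool :=
  sorted (fun B C => block_min C < block_min B) pi.

Definition refines pi pi' : Prop :=
  forall B, B \in pi' ->
    exists2 Cs : seq (seq nat), {subset Cs <= pi} & flatten Cs =i B.

End Partitions.

Definition NCCP (n : nat) : Type := {x : seq (seq nat) | is_nccp n x}.

(* The permutation, in one-line notation, with which pi is identified. *)
Definition word (n : nat) (pi : NCCP n) : seq nat := flatten (sval pi).

Definition NCCP312 (n : nat) : Type :=
  {x : NCCP n | ~~ contains312 (word x)}.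

Definition NCP (n : nat) : Type :=
  {x : NCCP n | noncrossing (sval x) && canonical (sval x)}.

Definition le_NCP (n : nat) (x y : NCP n) : Prop :=
  refines (sval (sval x)) (sval (sval y)).

Inductive bintree : Type :=
| Empty
| Node of bintree & nat & bintree.

Section Trees.

(* A node is designated by its label; the functions below are only meaningful
   on trees with pairwise distinct labels. *)
Implicit Types (t L : bintree) (x m n : nat).

Fixpoint inorder t : seq nat :=
  if t is Node l x r then inorder l ++ x :: inorder r else [::].

Definition root_label t : option nat :=
  if t is Node _ x _ then Some x else None.

Definition left_subtree t : bintree := if t is Node l _ _ then l else Empty.
Definition right_subtree t : bintree := if t is Node _ _ r then r else Empty.

Fixpoint increasing t : bool :=
  if t is Node l x r then
    [&& oapp (ltn x) true (root_label l), oapp (ltn x) true (root_label r),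
        increasing l & increasing r]
  else true.

Definition labeled_tree n t : bool :=
  perm_eq (inorder t) (iota 1 n) && increasing t.

(* The subtree of t rooted at x, Empty if x is not a node of t. *)
Fixpoint subtree_at t x : bintree :=
  if t is Node l y r then
    if x == y then t
    else if x \in inorder l then subtree_at l x else subtree_at r x
  else Empty.

Definition left_of t x : bintree := left_subtree (subtree_at t x).
Definition right_of t x : bintree := right_subtree (subtree_at t x).

Definition left_child t x : option nat := root_label (left_of t x).

Fixpoint replace_at t x u : bintree :=
  if t is Node l y r then
    if x == y then u else Node (replace_at l x u) y (replace_at r x u)
  else Empty.

(* p(x): the nodes from the root of t to x, both included. *)
Fixpoint root_path t x : seq nat :=
  if t is Node l y r then
    if x == y then [:: y]
    else if x \in inorder l then y :: root_path l x
    else if x \in inorder r then y :: root_path r x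
    else [::]
  else [::].

(* The root of t, its left (resp. right) child, the left (resp. right) child
   of that, etc. *)
Fixpoint left_chain t : seq nat :=
  if t is Node l x _ then x :: left_chain l else [::].
Fixpoint right_chain t : seq nat :=
  if t is Node _ x r then x :: right_chain r else [::].

(* The first element of s is the root; every other one is the left (resp.
   right) child of its predecessor. *)
Definition link_left (right_part : nat -> bintree) (s : seq nat) : bintree :=
  foldr (fun x t => Node t x (right_part x)) Empty s.
Definition link_right (left_part : nat -> bintree) (s : seq nat) : bintree :=
  foldr (fun x t => Node (left_part x) x t) Empty s.

Definition LS L n : seq nat :=
  [seq m <- root_path L n |
     (m != n) && oapp (fun c => c \in root_path L n) false (left_child L m)].

Definition is_right_to L n' n : bool :=
  has (fun c => (n' \in inorder (right_of L c)) && (n \in inorder (left_of L c)))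
      (inorder L).

(* The nodes of smaller label right to n, from left to right. *)
Definition smaller_right L n : seq nat :=
  [seq n' <- inorder L | (n' < n) && is_right_to L n' n].

Definition admissible_na L n na : bool :=
  (na \in LS L n) &&
  (if smaller_right L n is nl :: _ then
     let nc := \max_(m <- root_path L n | m \in root_path L nl) m in
     ~~ ((na \in root_path L nc) && (na != nc))
   else true).

(* The sequence m_0 = n, m_1, ..., m_p. *)
Definition m_chain L n : seq nat := left_chain (subtree_at L n).

Definition m_length L n : nat := (size (m_chain L n)).-1.

(* The nodes m_i with i in {1, ..., p} satisfying P; since labels increase
   along m_chain, this is in increasing label order. *)
Definition m_select L n (P : pred nat) : seq nat :=
  [seq nth 0 (m_chain L n) i | i <- iota 1 (m_length L n) & P i].

Definition tree1 L n (S : seq nat) : bintree :=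
  link_left (right_of L) (n :: m_select L n (fun i => i \in S)).

Definition tree2 L n n0 (S : seq nat) : bintree :=
  replace_at L n0
    (link_left (right_of L) (n0 :: m_select L n (fun i => i \notin S))).

Definition glue (T1 T2 : bintree) n na : bintree :=
  let left_part x :=
    if x \in inorder T1 then left_of T1 x else left_of T2 x in
  replace_at T2 na
    (link_right left_part
       (sort leq (right_chain (subtree_at T1 n)
                  ++ right_chain (subtree_at T2 na)))).

(* S lists the elements of a subset of {1, ..., p}; order and repetitions are
   irrelevant. *)
Definition is_rotation L L' : Prop :=
  exists n n0 na (S : seq nat),
    [/\ left_child L n0 = Some n,
        admissible_na L n na,
        all (fun i => 1 <= i <= m_length L n) S
      & L' = glue (tree1 L n S) (tree2 L n n0 S) n na].

End Trees.

(* As phi is the bijection reading labels in in-order, the trees L and L' below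
   are the inverse images of pi and pi' under phi. *)
Definition covers (n : nat) (pi pi' : NCCP n) : Prop :=
  exists L L' : bintree,
    [/\ labeled_tree n L, labeled_tree n L', inorder L = word pi,
        inorder L' = word pi' & is_rotation L L'].

Definition le_NCCP (n : nat) : NCCP n -> NCCP n -> Prop :=
  clos_refl_trans (NCCP n) (@covers n).

(* Intermediate elements of a chain may contain 312. *)
Definition le_NCCP312 (n : nat) (x y : NCCP312 n) : Prop :=
  le_NCCP (sval x) (sval y).

Section Orders.

Variables (T U : Type) (leT : T -> T -> Prop) (leU : U -> U -> Prop).

Definition partial_order : Prop :=
  [/\ forall x, leT x x,
      forall x y, leT x y -> leT y x -> x = y
    & forall x y z, leT x y -> leT y z -> leT x z].

Definition is_meet (x y m : T) : Prop :=
  [/\ leT m x, leT m y & forall z, leT z x -> leT z y -> leT z m].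

Definition is_join (x y j : T) : Prop :=
  [/\ leT x j, leT y j & forall z, leT x z -> leT y z -> leT j z].

Definition lattice_order : Prop :=
  partial_order /\
  (forall x y, (exists m, is_meet x y m) /\ (exists j, is_join x y j)).

Definition order_isomorphic : Prop :=
  exists2 f : T -> U, bijective f & forall x y, leT x y <-> leU (f x) (f y).

End Orders.

(* Main.v *)
(** Send a labeled tree to the partition of its labels into maximal right
   chains.  A rotation merges the chains of n and na and keeps every other right
   edge, so this map is monotone on all of NCCP(n).  A word avoids 312 exactly
   when its tree is labeled in preorder, and for such trees the partition is
   noncrossing and determines the tree.

   Conversely, let t be labeled in preorder and let E be a noncrossing
   equivalence relation containing its right edges.  If E relates two different
   chains of t, choose n not a right child with some smaller E-related label,
   and let a be the largest such label.  Since E is noncrossing, n lies in the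
   left subtree of a, and every node between them from which the path to n goes
   left has no right child.  Hence moving the whole subtree of n to the right of
   a is a rotation which keeps the labels in preorder and the right edges inside
   E.  Iterating, t reaches by rotations a tree whose chains are the classes of
   E.  Applied to suitable E, this gives surjectivity, the converse monotonicity,
   and the meets and joins of the Kreweras order. *)

Require Import Defs.
From Stdlib Require Import ClassicalEpsilon Operators_Properties.
From mathcomp Require Import zify.

Set Implicit Arguments.
Unset Strict Implicit.
Unset Printing Implicit Defensive.

(** * Partitions and words *)

Implicit Types (pi : seq (seq nat)) (B C : seq nat) (n x y z : nat).

Definition same_block (pi : seq (seq nat)) (x y : nat) : bool :=
  has (fun B => (x \in B) && (y \in B)) pi.

Lemma same_blockP pi x y :
  reflect (exists B, [/\ B \in pi, x \in B & y \in B]) (same_block pi x y).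
Proof.
apply: (iffP hasP) => [[B Bpi /andP[xB yB]]|[B [Bpi xB yB]]]; exists B => //.
by rewrite xB.
Qed.

Lemma same_block_sym pi x y : same_block pi x y = same_block pi y x.
Proof. by rewrite /same_block; apply: eq_has => B; rewrite andbC. Qed.

Lemma uniq_flatten_block (pi : seq (seq nat)) B C x :
  uniq (flatten pi) -> B \in pi -> C \in pi -> x \in B -> x \in C -> B = C.
Proof.
elim: pi => //= D pi IH; rewrite cat_uniq => /and3P[_ /hasPn dis Upi].
have absurd F : F \in pi -> x \in F -> x \in D -> False.
  move=> Fpi xF xD; have /dis : x \in flatten pi by apply/flattenP; exists F.
  by rewrite /= xD.
rewrite !inE => /orP[/eqP->|Bpi] /orP[/eqP->|Cpi] xB xC //; last exact: IH.
- by case: (absurd C).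
- by case: (absurd B).
Qed.

Lemma same_block_trans pi x y z : uniq (flatten pi) ->
  same_block pi x y -> same_block pi y z -> same_block pi x z.
Proof.
move=> U /same_blockP[B [Bpi xB yB]] /same_blockP[C [Cpi yC zC]].
apply/same_blockP; exists B; split=> //.
by rewrite (uniq_flatten_block U Bpi Cpi yB yC).
Qed.

Lemma same_block_refl pi x : (x \in flatten pi) = same_block pi x x.
Proof.
by apply/flattenP/same_blockP => [[B]|[B []]]; exists B.
Qed.

Lemma same_block_mem pi x y :
  same_block pi x y -> (x \in flatten pi) && (y \in flatten pi).
Proof.
move=> /same_blockP[B [Bpi xB yB]].
by apply/andP; split; apply/flattenP; exists B.
Qed.

(** Turns refinement into an inclusion of relations, the form used in every later comparison. For
    the converse, the blocks of [pi] contained in [B] serve as the family whose union is [B]. *)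
Lemma refinesP pi pi' :
  uniq (flatten pi) -> uniq (flatten pi') -> flatten pi =i flatten pi' ->
  refines pi pi' <-> (forall x y, same_block pi x y -> same_block pi' x y).
Proof.
move=> U U' eqpi; split=> [ref x y /same_blockP[C [Cpi xC yC]]|sub B Bpi'].
  have : x \in flatten pi' by rewrite -eqpi; apply/flattenP; exists C.
  case/flattenP=> B Bpi' xB; have [Cs Cspi eqB] := ref _ Bpi'.
  have /flattenP[D DCs xD] : x \in flatten Cs by rewrite eqB.
  apply/same_blockP; exists B; split=> //; rewrite -eqB; apply/flattenP.
  by exists D => //; rewrite (uniq_flatten_block U (Cspi _ DCs) Cpi xD xC).
exists [seq C <- pi | all (mem B) C] => [C|x]; first by rewrite mem_filter => /andP[].
apply/flattenP/idP => [[C]|xB].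
  by rewrite mem_filter => /andP[/allP CB _] xC; apply: CB.
have /flattenP[C Cpi xC] : x \in flatten pi.
  by rewrite eqpi; apply/flattenP; exists B.
exists C => //; rewrite mem_filter Cpi andbT; apply/allP => y yC.
have /same_blockP[D [Dpi' xD yD]] : same_block pi' x y.
  by apply: sub; apply/same_blockP; exists C.
by rewrite /= (uniq_flatten_block U' Bpi' Dpi' xB xD).
Qed.

Lemma block_min_sorted B : sorted ltn B -> block_min B = head 0 B.
Proof.
case: B => [|x B] /= sB; rewrite /block_min ?big_nil //= big_cons.
have /allP xB : all (ltn x) B by apply: order_path_min sB; apply: ltn_trans.
apply/minn_idPl; rewrite big_seq; elim/big_ind: _ => // [y z|y /xB /ltnW //].
by rewrite leq_min => -> ->.
Qed.

Lemma head_le_block_max B : head 0 B <= block_max B.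
Proof. by case: B => [|x B] //=; rewrite /block_max big_cons leq_maxl. Qed.

Lemma block_max_sorted B : sorted ltn B -> block_max B = last 0 B.
Proof.
elim/last_ind: B => [|B x _] sB; first by rewrite /block_max big_nil.
rewrite last_rcons /block_max big_rcons /=; apply/maxn_idPr.
apply/bigmax_leqP_seq => y yB _; move: sB.
rewrite sorted_pairwise ?pairwise_rcons; last exact: ltn_trans.
by case/andP=> /allP /(_ _ yB) /ltnW.
Qed.

Section Nccp.

Variables (n : nat) (pi : seq (seq nat)).
Hypothesis pi_nccp : is_nccp n pi.

Lemma nccp_uniq : uniq (flatten pi).
Proof. by case/and3P: pi_nccp => /perm_uniq-> _ _; apply: iota_uniq. Qed.

Lemma nccp_mem x : (x \in flatten pi) = (0 < x <= n).
Proof. by case/and3P: pi_nccp => /perm_mem-> _ _; rewrite mem_iota add1n ltnS. Qed.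

Lemma nccp_block B : B \in pi -> (B != [::]) && sorted ltn B.
Proof. by case/and3P: pi_nccp => _ /allP H _ /H. Qed.

End Nccp.

Lemma refines_nccp n pi pi' : is_nccp n pi -> is_nccp n pi' ->
  refines pi pi' <-> (forall x y, same_block pi x y -> same_block pi' x y).
Proof.
move=> H H'; apply: refinesP (nccp_uniq H) (nccp_uniq H') _ => x.
by rewrite (nccp_mem H) (nccp_mem H').
Qed.

(** The relation fixes the set of blocks, each block being sorted, and decreasing minima leave only
    one way to list that set. *)
Lemma same_block_inj n pi pi' : is_nccp n pi -> is_nccp n pi' ->
  canonical pi -> canonical pi' ->
  (forall x y, same_block pi x y <-> same_block pi' x y) -> pi = pi'.
Proof.
move=> H H' c c' eqb.
have sub p p' : is_nccp n p -> is_nccp n p' ->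
    (forall x y, same_block p x y <-> same_block p' x y) -> {subset p <= p'}.
  move=> {}H {}H' {}eqb B Bp; have /andP[B0 sB] := nccp_block H Bp.
  have [x xB] : exists x, x \in B by case: B B0 {Bp sB} => // x B; exists x; apply: mem_head.
  have /same_blockP[C [Cp' xC _]] : same_block p' x x.
    by apply/eqb/same_blockP; exists B.
  suff -> : B = C by [].
  have /andP[_ sC] := nccp_block H' Cp'.
  apply: (irr_sorted_eq ltn_trans ltnn) => // y.
  apply/idP/idP => yBC.
    have /same_blockP[D [Dp' xD yD]] : same_block p' x y.
      by apply/eqb/same_blockP; exists B.
    by rewrite (uniq_flatten_block (nccp_uniq H') Cp' Dp' xC xD).
  have /same_blockP[D [Dp' xD yD]] : same_block p x y.
    by apply/eqb/same_blockP; exists C.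
  by rewrite (uniq_flatten_block (nccp_uniq H) Bp Dp' xB xD).
apply: (irr_sorted_eq (leT := fun B C => block_min C < block_min B)) => //.
- by move=> A B C /= hA hB; apply: ltn_trans hA.
- by move=> B; rewrite ltnn.
- by move=> B; apply/idP/idP; [apply: sub|apply: sub] => // x y; split=> /eqb.
Qed.

(** * Cutting a word at its descents *)

Fixpoint runs (w : seq nat) : seq (seq nat) :=
  if w is x :: w' then
    if runs w' is (y :: B) :: pi then
      if x < y then (x :: y :: B) :: pi else [:: x] :: (y :: B) :: pi
    else [:: [:: x]]
  else [::].

(** A letter in front either extends the first run or opens a run of its own. In the second case
    distinctness makes the comparison strict, and the new run is a singleton, so its maximum is the
    letter itself. *)
Lemma runs_spec w : uniq w ->
  [/\ flatten (runs w) = w, all (fun B => (B != [::]) && sorted ltn B) (runs w)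
    & sorted (fun B C => block_max B > block_min C) (runs w)].
Proof.
elim: w => [|x w IH] //= /andP[xw /IH [{IH}]].
case: (runs w) => [|[|y B] pi] /= fw //; first by rewrite -fw.
rewrite -{}fw in xw *; case: ltnP => /= xy.
  case/andP=> sB ap so; rewrite xy sB; split=> //.
  case: pi so {ap xw} => //= C pi /andP[mC ->]; rewrite andbT.
  apply: (leq_trans mC); rewrite /block_max [X in _ <= X]big_cons leq_maxr //.
case/andP=> sB ap so; rewrite sB; split=> //=.
rewrite so andbT block_min_sorted //= /block_max big_seq1.
by move: xw xy; rewrite inE negb_or; case: ltngtP.
Qed.

Lemma runs_nccp n w : perm_eq w (iota 1 n) -> is_nccp n (runs w).
Proof.
move=> pw; have := @runs_spec w; rewrite (perm_uniq pw) iota_uniq.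
by case=> // fw aw sw; apply/and3P; rewrite fw.
Qed.

(** With [runs_spec] this shows that a crossing partition and its word determine each other. *)
Lemma flatten_runs pi : all (fun B => (B != [::]) && sorted ltn B) pi ->
  sorted (fun B C => block_max B > block_min C) pi -> runs (flatten pi) = pi.
Proof.
elim: pi => //= B pi IH /andP[/andP[B0 sB] ap] so.
have {}IH : runs (flatten pi) = pi by apply: IH => //; apply: path_sorted so.
elim/last_ind: B B0 sB so => // B z _ _ sB so.
(* The condition on maximum and minimum compares only the last letter [z] of the first block with
   the first letter [y] of the next one, so the junction is a descent. *)
have {so} : ohead pi = None \/ exists y C p, pi = (y :: C) :: p /\ y < z.
  case: pi ap so {IH} => [|[|y C] p] //=; first by left.
  case/andP=> sC _ /andP[]; rewrite block_max_sorted // last_rcons.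
  by rewrite block_min_sorted //= => yz _; right; exists y, C, p.
move: IH; set w := flatten pi => eqw H.
have {H eqw} rz : runs (z :: w) = [:: z] :: pi.
  rewrite /= eqw; case: H => [|[y [C [p [-> yz]]]]]; first by case: (pi).
  by rewrite ltnNge ltnW.
rewrite cat_rcons; elim: B sB => // x B IH sB.
rewrite [_ ++ _]/= /= -[runs (B ++ _)]/(runs (B ++ z :: w)) IH ?(path_sorted sB) //.
by case: (B) sB => [|b B'] /= /andP[-> _].
Qed.

Lemma word_inj n : injective (@word n).
Proof.
move=> [pi H] [pi' H']; rewrite /word /= => e; apply: val_inj => /=.
case/and3P: H => _ a s; case/and3P: H' => _ a' s'.
by rewrite -(flatten_runs a s) e flatten_runs.
Qed.

Lemma word_perm n (x : NCCP n) : perm_eq (word x) (iota 1 n).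
Proof. by case: x => pi H; case/and3P: (H). Qed.

Definition nccp_of_word n w (pw : perm_eq w (iota 1 n)) : NCCP n :=
  exist _ (runs w) (runs_nccp pw).

Lemma word_nccp_of_word n w (pw : perm_eq w (iota 1 n)) :
  word (nccp_of_word pw) = w.
Proof. by case: (@runs_spec w) => //; rewrite (perm_uniq pw) iota_uniq. Qed.

(** * Right chains and right edges *)

Implicit Types (t u : bintree).

Definition right_edges_at x t : seq (nat * nat) :=
  oapp (fun y => [:: (x, y)]) [::] (root_label t).

Fixpoint redges t : seq (nat * nat) :=
  if t is Node l x r then redges l ++ right_edges_at x r ++ redges r else [::].

Definition top_block t : seq (seq nat) :=
  if t is Node _ _ _ then [:: right_chain t] else [::].

(** The maximal right chains other than the one through the root. The right subtree comes first and
    the chain through the root last, so that the first entries decrease when the tree is labeled in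
    preorder; this is the canonical order. *)
Fixpoint inner_blocks t : seq (seq nat) :=
  if t is Node l _ r then inner_blocks r ++ inner_blocks l ++ top_block l
  else [::].

Definition blocks t : seq (seq nat) := inner_blocks t ++ top_block t.

Definition steps (s : seq nat) : seq (nat * nat) := zip s (behead s).


Lemma flatten_top_block t : flatten (top_block t) = right_chain t.
Proof. by case: t => //= *; rewrite cats0. Qed.

Lemma perm_blocks t : perm_eq (flatten (blocks t)) (inorder t).
Proof.
elim: t => // l /permP IHl x r /permP IHr; apply/permP => p.
have := IHl p; have := IHr p.
rewrite /blocks /= !flatten_cat /=.
rewrite !flatten_top_block !count_cat /= !count_cat /=; lia.
Qed.

Lemma mem_redges_blocks t : redges t =i flatten [seq steps B | B <- blocks t].
Proof.
have top u : flatten [seq steps B | B <- top_block u] = steps (right_chain u).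
  by case: u => //= *; rewrite cats0.
elim: t => // l IHl x r IHr e; rewrite /blocks /= !map_cat !flatten_cat /=.
rewrite !mem_cat IHl IHr /blocks !map_cat !flatten_cat !mem_cat !top /=.
have -> : e \in steps (x :: right_chain r) =
    (e \in right_edges_at x r) || (e \in steps (right_chain r)).
  by case: (r) => //= lr y rr; rewrite !inE.
by rewrite in_nil orbF; do 5?[case: (e \in _); rewrite /= ?orbT //].
Qed.

Lemma redges_mem t x y :
  (x, y) \in redges t -> x \in inorder t /\ y \in inorder t.
Proof.
elim: t => //= l IHl z r IHr; rewrite !mem_cat !inE.
case/or3P=> [/IHl[-> ->]|e|/IHr[-> ->]]; rewrite ?orbT //.
case: r e {IHr} => //= lr w rr; rewrite inE => /eqP[-> ->].
by rewrite !mem_cat !inE !eqxx !orbT.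
Qed.


Lemma mem_steps s x y : (x, y) \in steps s -> x \in s /\ y \in s.
Proof.
rewrite /steps; case: s => //= z s; elim: s z => //= w s IH z.
rewrite inE => /orP[/eqP[-> ->]|/IH[xs ys]]; first by rewrite !inE !eqxx orbT.
by rewrite !(in_cons z) xs ys !orbT.
Qed.

Lemma redges_same_block t x y : (x, y) \in redges t -> same_block (blocks t) x y.
Proof.
rewrite mem_redges_blocks => /flattenP[_ /mapP[B Bt ->] /mem_steps[xB yB]].
by apply/same_blockP; exists B.
Qed.

(** Transitivity along the chain passes from consecutive entries to arbitrary ones. *)
Lemma steps_same_block pi s x y : uniq (flatten pi) -> {subset s <= flatten pi} ->
    (forall a b, (a, b) \in steps s -> same_block pi a b) ->
  x \in s -> y \in s -> same_block pi x y.
Proof.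
move=> U; case: s => // z s spi H.
suff head w : w \in z :: s -> same_block pi z w.
  move=> /head zx /head zy; apply: same_block_trans zy => //.
  by rewrite same_block_sym.
elim: s z spi H w => [|z' s IH] z spi H w.
  by rewrite inE => /eqP->; rewrite -same_block_refl spi ?mem_head.
rewrite inE => /orP[/eqP->|ws]; first by rewrite -same_block_refl spi ?mem_head.
have zz' : same_block pi z z' by apply: H; rewrite /steps /= mem_head.
apply: same_block_trans zz' _ => //; apply: IH => // [v vs|a b ab].
  by apply: spi; rewrite inE vs orbT.
by apply: H; rewrite /steps /= inE ab orbT.
Qed.

(** The blocks of a tree are generated by its right edges, so an inclusion of relations has to be
    checked on these edges only. *)
Lemma same_block_blocks_sub t pi x y :
    uniq (flatten pi) -> {subset inorder t <= flatten pi} ->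
    (forall a b, (a, b) \in redges t -> same_block pi a b) ->
  same_block (blocks t) x y -> same_block pi x y.
Proof.
move=> U sub H /same_blockP[B [Bt xB yB]].
apply: (steps_same_block (s := B)) => // [z zB|a b ab].
  by apply: sub; rewrite -(perm_mem (perm_blocks t)); apply/flattenP; exists B.
by apply: H; rewrite mem_redges_blocks; apply/flattenP; exists (steps B); rewrite ?map_f.
Qed.

Lemma uniq_blocks t : uniq (flatten (blocks t)) = uniq (inorder t).
Proof. exact: perm_uniq (perm_blocks t). Qed.

Lemma mem_blocks t : flatten (blocks t) =i inorder t.
Proof. exact: perm_mem (perm_blocks t). Qed.

(** * Subtrees, their replacement, and right edges *)

Lemma uniq_node l x r : uniq (inorder (Node l x r)) =
  [&& x \notin inorder l, x \notin inorder r, uniq (inorder l), uniq (inorder r)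
    & ~~ has (mem (inorder l)) (inorder r)].
Proof.
rewrite /= cat_uniq /= negb_or.
case: (uniq (inorder l)); case: (uniq (inorder r)); case: (_ \in inorder l);
  by case: (_ \in inorder r); rewrite /= ?andbT ?andbF.
Qed.

Lemma uniq_nodeP l x r : uniq (inorder (Node l x r)) ->
  [/\ uniq (inorder l), uniq (inorder r), x \notin inorder l, x \notin inorder r
    & forall y, y \in inorder l -> y \in inorder r -> False].
Proof.
rewrite uniq_node => /and5P[-> -> -> -> /hasPn dis]; split=> // y yl /dis /=.
by rewrite yl.
Qed.

Lemma replace_at_notin t x u : x \notin inorder t -> replace_at t x u = t.
Proof.
elim: t => //= l IHl y r IHr.
rewrite mem_cat inE !negb_or => /and3P[xl /negPf-> xr].
by rewrite IHl ?IHr.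
Qed.

Lemma subtree_atP t x : x \in inorder t ->
  exists l r, subtree_at t x = Node l x r.
Proof.
elim: t => //= l IHl y r IHr; rewrite mem_cat inE.
case: eqVneq => [->|_]; first by exists l, r.
by case: (x \in inorder l) IHl => [IH _|_ /=]; [apply: IH|apply: IHr].
Qed.

Lemma subtree_at_notin t x : x \notin inorder t -> subtree_at t x = Empty.
Proof.
elim: t => //= l IHl y r IHr.
by rewrite mem_cat inE !negb_or => /and3P[/negPf-> /negPf-> /IHr].
Qed.

Lemma inorder_replace_at t x : uniq (inorder t) -> x \in inorder t ->
  exists v w, inorder t = v ++ inorder (subtree_at t x) ++ w /\
    forall u, inorder (replace_at t x u) = v ++ inorder u ++ w.
Proof.
elim: t => // l IHl y r IHr U; have [Ul Ur yl yr lr] := uniq_nodeP U.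
rewrite /= mem_cat inE; case: eqVneq => [->|_] /=.
  by exists [::], [::]; rewrite !cats0; split=> // u; rewrite cats0.
case: ifPn => [xl _|xl /= xr].
  have [v [w [-> E]]] := IHl Ul xl.
  exists v, (w ++ y :: inorder r); split=> [|u]; first by rewrite -!catA.
  by rewrite E -!catA replace_at_notin //; apply/negP => /(lr _ xl).
have [v [w [-> E]]] := IHr Ur xr.
exists (inorder l ++ y :: v), w; split=> [|u]; first by rewrite -!catA.
by rewrite E -!catA replace_at_notin.
Qed.

Lemma subtree_at_sub t x : {subset inorder (subtree_at t x) <= inorder t}.
Proof.
elim: t => //= l IHl y r IHr z; case: ifP => // _.
by case: ifP => _ zs; rewrite mem_cat inE ?(IHl _ zs) ?(IHr _ zs) ?orbT.
Qed.

Lemma subtree_at_uniq t x : uniq (inorder t) -> uniq (inorder (subtree_at t x)).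
Proof.
elim: t => // l IHl y r IHr U; have [Ul Ur _ _ _] := uniq_nodeP U.
by rewrite /=; case: ifP => // _; case: ifP => _; [apply: IHl|apply: IHr].
Qed.

Lemma subtree_at_trans t x y : uniq (inorder t) ->
  y \in inorder (subtree_at t x) -> subtree_at (subtree_at t x) y = subtree_at t y.
Proof.
elim: t => // l IHl z r IHr U; have [Ul Ur zl zr lr] := uniq_nodeP U.
rewrite [subtree_at _ x]/=; case: ifP => // _.
case: ifPn => xl ys /=.
  have yl := subtree_at_sub ys; rewrite yl IHl //.
  by case: eqP => // E; rewrite -E yl in zl.
have yr := subtree_at_sub ys; rewrite IHr //.
case: eqP => [E|_]; first by rewrite -E yr in zr.
by case: ifP => // /lr /(_ yr).
Qed.

Lemma left_child_subtree t x y : uniq (inorder t) -> left_child t x = Some y ->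
  exists l r r', subtree_at t x = Node (Node l y r) x r' /\
    subtree_at t y = Node l y r.
Proof.
move=> U E; have xt : x \in inorder t.
  apply/negPn/negP => /subtree_at_notin xt.
  by rewrite /left_child /left_of xt in E.
have [l' [r' Ex]] := subtree_atP xt; move: E.
rewrite /left_child /left_of Ex /=.
case: l' Ex => // l z r Ex /= [Ez]; subst z; exists l, r, r'; split=> //.
have Us := subtree_at_uniq x U.
rewrite -(@subtree_at_trans t x y) // Ex; last by rewrite /= !mem_cat inE eqxx orbT.
rewrite Ex in Us; have [_ _ xl _ _] := uniq_nodeP Us.
have yl : y \in inorder (Node l y r) by rewrite /= mem_cat inE eqxx orbT.
rewrite /= -/(inorder (Node l y r)) yl eqxx.
by case: eqP => // E; rewrite -E yl in xl.
Qed.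

Lemma root_label_replace_at t x u : 
  root_label (replace_at t x u) =
  if root_label t == Some x then root_label u else root_label t.
Proof.
case: t => //= l y r; rewrite /eq_op /= eq_sym -/(eq_op _ _).
by case: eqVneq.
Qed.

Lemma right_edges_atP x t a b :
  reflect (a = x /\ root_label t = Some b) ((a, b) \in right_edges_at x t).
Proof.
rewrite /right_edges_at; case: t => [|l y r] /=; first by right=> -[].
rewrite inE xpair_eqE; apply: (iffP andP) => [[/eqP-> /eqP->]//|[-> [->]]].
by rewrite !eqxx.
Qed.

Lemma mem_right_edges x t y :
  root_label t = Some y -> (x, y) \in right_edges_at x t.
Proof. by move=> ty; apply/right_edges_atP. Qed.

(** The third case is the edge entering [x]: its upper end stays, and after the replacement it leads
    to the root of [u], whatever label that root has. *)
Lemma redges_replace_at t x u a b : uniq (inorder t) -> (a, b) \in redges t ->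
  [\/ (a, b) \in redges (subtree_at t x), (a, b) \in redges (replace_at t x u)
    | b = x /\
      forall y, root_label u = Some y -> (a, y) \in redges (replace_at t x u)].
Proof.
elim: t => // l IHl y r IHr U; have [Ul Ur yl yr lr] := uniq_nodeP U.
move=> ab; rewrite [replace_at _ _ _]/= [subtree_at _ _]/=.
case: ifP => _; first by constructor 1.
move: ab; rewrite /= !mem_cat; case: ifPn => xl.
  rewrite [replace_at r _ _]replace_at_notin; last by apply/negP => /(lr _ xl).
  case/or3P=> [/(IHl Ul) [-> | -> | [-> H]]|->|->]; rewrite ?orbT;
    [by constructor 1|by constructor 2| |by constructor 2|by constructor 2].
  by constructor 3; split=> // z /H; rewrite !mem_cat => ->.
rewrite [replace_at l _ _]replace_at_notin //.
case/or3P=> [->|/right_edges_atP[-> rb]|/(IHr Ur) [-> | -> | [-> H]]];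
  rewrite ?orbT; [by constructor 2| |by constructor 1|by constructor 2|].
  have root z : root_label (replace_at r x u) = Some z ->
      (y, z) \in redges (Node l y (replace_at r x u)).
    by move=> rz; rewrite /= !mem_cat mem_right_edges ?orbT.
  have := root_label_replace_at r x u; rewrite rb.
  case: eqP => [[->]|_] E; last first.
    by constructor 2; have := root _ E; rewrite /= !mem_cat.
  by constructor 3; split=> // z uz; apply: root; rewrite E.
by constructor 3; split=> // z /H; rewrite !mem_cat => ->; rewrite !orbT.
Qed.

Lemma redges_replaced t x u : x \in inorder t ->
  {subset redges u <= redges (replace_at t x u)}.
Proof.
elim: t => //= l IHl y r IHr; rewrite mem_cat inE; case: eqVneq => [_ _ //|_ /=].
by case/orP=> [xl|xr] e eu; rewrite /= !mem_cat ?(IHl xl e eu) ?(IHr xr e eu) ?orbT.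
Qed.

(** * Trees linked along a left or a right chain *)

Lemma redges_link_left R s :
  redges (link_left R s) =i flatten [seq redges (Node Empty x (R x)) | x <- s].
Proof.
elim: s => //= x s IH e; rewrite !mem_cat IH.
by do 3?[case: (e \in _); rewrite /= ?orbT //].
Qed.

Lemma inorder_link_left R s :
  perm_eq (inorder (link_left R s)) (flatten [seq x :: inorder (R x) | x <- s]).
Proof. by elim: s => //= x s IH; rewrite perm_catC /= perm_cons perm_cat2l. Qed.

Lemma redges_link_right lp s :
  redges (link_right lp s) =i steps s ++ flatten [seq redges (lp x) | x <- s].
Proof.
elim: s => //= x s IH e; rewrite !mem_cat IH !mem_cat.
have -> : e \in steps (x :: s) =
    (e \in right_edges_at x (link_right lp s)) || (e \in steps s).
  by case: (s) => //= y s'; rewrite !inE.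
by do 4?[case: (e \in _); rewrite /= ?orbT //].
Qed.

Lemma right_chain_link_right lp s : right_chain (link_right lp s) = s.
Proof. by elim: s => //= x s ->. Qed.

Lemma left_chain_mem t : {subset left_chain t <= inorder t}.
Proof.
elim: t => //= l IHl x r _ y; rewrite inE mem_cat inE => /orP[->|/IHl->//].
by rewrite orbT.
Qed.

Lemma right_chain_mem t : {subset right_chain t <= inorder t}.
Proof.
elim: t => //= l _ x r IHr y; rewrite inE mem_cat inE => /orP[->|/IHr->//].
  by rewrite orbT.
by rewrite !orbT.
Qed.

(** Puts a subtree of the original tree into the linked form in which [tree1] and [tree2] are given.
    The function [R] matters on the chain only. *)
Lemma link_left_chain t R : uniq (inorder t) ->
  {in left_chain t, R =1 right_of t} -> link_left R (left_chain t) = t.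
Proof.
elim: t => // l IHl x r _ U H; have [Ul _ xl _ lr] := uniq_nodeP U.
rewrite /= H /= ?mem_head // /right_of /= eqxx /= IHl // => y yl.
have yl' := left_chain_mem yl.
rewrite H /= ?inE ?yl ?orbT // /right_of /= yl'.
by case: eqP => // E; rewrite -E yl' in xl.
Qed.

Lemma link_right_chain t lp : uniq (inorder t) ->
  {in right_chain t, lp =1 left_of t} -> link_right lp (right_chain t) = t.
Proof.
elim: t => // l _ x r IHr U H; have [_ Ur _ xr lr] := uniq_nodeP U.
rewrite /= H /= ?mem_head // /left_of /= eqxx /= IHr // => y yr.
have yr' := right_chain_mem yr.
rewrite H /= ?inE ?yr ?orbT // /left_of /=.
case: eqP => [E|_]; first by rewrite -E yr' in xr.
by case: ifP => // /lr /(_ yr').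
Qed.

(** * Monotonicity of rotations *)

Lemma m_select_predC L n (P : pred nat) :
  perm_eq (m_select L n P ++ m_select L n (predC P)) (behead (m_chain L n)).
Proof.
rewrite /m_select -map_cat.
have /(perm_map (nth 0 (m_chain L n))) := permEl (perm_filterC P (iota 1 (m_length L n))).
move=> /permPl E; rewrite {}E map_nth_iota; last by rewrite subn1.
rewrite drop1 take_oversize //.
by rewrite size_behead.
Qed.

Section RotationParts.

Variables (L : bintree) (n n0 : nat) (S : seq nat).
Hypotheses (UL : uniq (inorder L)) (Ln0 : left_child L n0 = Some n).

Let kept := link_left (right_of L) (n0 :: m_select L n (fun i => i \notin S)).

Lemma right_of_left_chain y : y \in left_chain (subtree_at L n) ->
  right_of L y = right_of (subtree_at L n) y.
Proof. by move=> /left_chain_mem yX; rewrite /right_of subtree_at_trans. Qed.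

Lemma perm_rotation_parts :
  perm_eq ((n :: m_select L n (fun i => i \in S)) ++
    n0 :: m_select L n (fun i => i \notin S)) (n0 :: m_chain L n).
Proof.
have [l [r [r' [_ En]]]] := left_child_subtree UL Ln0.
apply/permP => p; have /permP/(_ p) := m_select_predC L n (fun i => i \in S).
have -> : m_chain L n = n :: behead (m_chain L n) by rewrite /m_chain En.
rewrite /= !count_cat /= => <-.
rewrite -[m_select _ _ (predC _)]/(m_select L n (fun i => i \notin S)); lia.
Qed.

(** The nodes [n0], [n] and the [m_i] are shared out between the two trees, each together with its
    right subtree, and nothing else moves. *)
Lemma inorder_rotation_parts :
  perm_eq (inorder (tree1 L n S) ++ inorder (tree2 L n n0 S)) (inorder L).
Proof.
have [l [r [r' [En0 En]]]] := left_child_subtree UL Ln0.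
have n0L : n0 \in inorder L.
  by apply: (@subtree_at_sub _ n0); rewrite En0 /= !(mem_cat, inE) eqxx !orbT.
have [v [w [EL ET]]] := inorder_replace_at UL n0L.
rewrite /tree2 ET EL perm_catCA perm_cat2l catA perm_cat2r En0.
have UX := subtree_at_uniq n UL.
set g := fun x => x :: inorder (right_of L x).
have gX : perm_eq (flatten [seq g x | x <- m_chain L n]) (inorder (Node l n r)).
  rewrite -[X in perm_eq _ (inorder X)]En.
  rewrite -[X in perm_eq _ (inorder X)](link_left_chain UX (R := right_of L)).
    by rewrite perm_sym inorder_link_left.
  exact: right_of_left_chain.
have gn0 : g n0 = n0 :: inorder r' by rewrite /g /right_of En0.
apply: perm_trans (perm_cat (inorder_link_left _ _) (inorder_link_left _ _)) _.
rewrite -flatten_cat -map_cat -/g.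
have P := perm_rotation_parts.
apply: perm_trans (perm_flatten (perm_map g P)) _.
rewrite map_cons gn0 [flatten _]/= -cat_cons perm_catC.
by rewrite [inorder (Node (Node l n r) _ _)]/= -/(inorder (Node l n r)) perm_cat2r.
Qed.

(** Splitting the left chain breaks left edges only, since each node of the chain keeps its right
    subtree. *)
Lemma redges_rotation_parts a b : (a, b) \in redges L ->
  (a, b) \in redges (tree1 L n S) ++ redges (tree2 L n n0 S).
Proof.
have [l [r [r' [En0 En]]]] := left_child_subtree UL Ln0.
have n0L : n0 \in inorder L.
  by apply: (@subtree_at_sub _ n0); rewrite En0 /= !(mem_cat, inE) eqxx !orbT.
have UX := subtree_at_uniq n UL.
rewrite mem_cat /tree2 -/kept.
have rk : root_label kept = Some n0 by [].
(* The root of [kept] is again [n0], so a right edge entering [n0] survives unchanged. *)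
case/(redges_replace_at n0 kept UL) => [|->|[-> /(_ _ rk) ->]]; rewrite ?orbT //.
rewrite En0 => abX.
have : (a, b) \in redges (tree1 L n S) ++ redges kept; last first.
  by rewrite mem_cat => /orP[->//|/(redges_replaced n0L)->]; rewrite orbT.
have P := perm_mem perm_rotation_parts.
set g := fun x => redges (Node Empty x (right_of L x)).
have : exists2 x, x \in n0 :: m_chain L n & (a, b) \in g x.
  move: abX; rewrite -[redges _]/(redges (Node l n r) ++ _) mem_cat.
  case/orP=> [|H].
    rewrite -En -[X in redges X](link_left_chain UX (R := right_of L));
      last exact: right_of_left_chain.
    rewrite redges_link_left => /flattenP[_ /mapP[x xc ->] xab].
    by exists x; rewrite // inE xc orbT.
  exists n0; first by rewrite mem_head.
  by rewrite /g /right_of En0.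
case=> x; rewrite -P mem_cat => xs xab.
rewrite mem_cat !redges_link_left.
by apply/orP; case/orP: xs => xs; [left|right]; apply/flattenP; exists (g x); rewrite // map_f.
Qed.

End RotationParts.

(** Every right edge of [L] is found in one of the two parts. Gluing then merges two right chains
    into one and leaves the remaining right edges in place, except that the edge entering [na] may
    get a new lower end on the merged chain. *)
Lemma rotation_same_block N L L' a b :
    labeled_tree N L -> labeled_tree N L' -> is_rotation L L' ->
  same_block (blocks L) a b -> same_block (blocks L') a b.
Proof.
move=> /andP[pL _] /andP[pL' _] [n [n0 [na [S [Ln0 _ _ EL']]]]].
have UL : uniq (inorder L) by rewrite (perm_uniq pL) iota_uniq.
have UL' : uniq (inorder L') by rewrite (perm_uniq pL') iota_uniq.
have P := inorder_rotation_parts S UL Ln0.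
have := perm_uniq P; rewrite UL cat_uniq => /and3P[U1 /hasPn dis U2].
apply: same_block_blocks_sub => [|x|{}a {}b]; first by rewrite uniq_blocks.
  by rewrite mem_blocks (perm_mem pL) (perm_mem pL').
move=> /(redges_rotation_parts S UL Ln0); rewrite mem_cat.
have [l [r [r' [En0 En]]]] := left_child_subtree UL Ln0.
move: EL' U1 U2 dis P; rewrite /glue.
have T1n : subtree_at (tree1 L n S) n = tree1 L n S by rewrite /= eqxx.
have nT1 : 0 < size (inorder (tree1 L n S)) by rewrite /= size_cat addnS.
rewrite T1n; move: (tree1 L n S) (tree2 L n n0 S) nT1 => T1 T2 nT1.
set lp := fun x => _; set s := sort leq _.
move=> EL' U1 U2 dis P ab.
(* Otherwise the replacement at [na] would do nothing, and [L'] would lack the nodes of the nonempty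
   tree [T1]. *)
have naT2 : na \in inorder T2.
  apply/negPn/negP => /replace_at_notin E; rewrite E in EL'.
  have := perm_size P; rewrite (perm_size pL) -(perm_size pL') EL' size_cat.
  by rewrite -[RHS]add0n => /addIn E0; rewrite E0 in nT1.
have [l2 [r2 Ena]] := subtree_atP naT2.
have sub : {subset redges (link_right lp s) <= redges L'}.
  by rewrite EL'; apply: redges_replaced.
have subm : {subset inorder (link_right lp s) <= inorder L'}.
  have [v [w [_ E]]] := inorder_replace_at U2 naT2.
  by move=> x xs; rewrite EL' E !mem_cat xs orbT.
(* The glued chain s lies in a single right chain of L'. *)
have ss x y : x \in s -> y \in s -> same_block (blocks L') x y.
  move=> xs ys; apply: (steps_same_block (s := s)) => //; first by rewrite uniq_blocks.
    move=> z zs; rewrite mem_blocks; apply: subm.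
    by apply: right_chain_mem; rewrite right_chain_link_right.
  move=> c d cd; apply/redges_same_block/sub.
  by rewrite redges_link_right mem_cat cd.
have inl x c d : x \in s -> (c, d) \in redges (lp x) -> same_block (blocks L') c d.
  move=> xs cd; apply/redges_same_block/sub; rewrite redges_link_right mem_cat.
  by apply/orP; right; apply/flattenP; exists (redges (lp x)); rewrite ?map_f.
have mems x : (x \in s) =
    (x \in right_chain T1) || (x \in right_chain (subtree_at T2 na)).
  by rewrite mem_sort mem_cat.
have Una := subtree_at_uniq na U2.
(* Used for both glued trees: an edge on the right chain joins two members of [s], and any other
   edge lies in a left part that is carried over. *)
have chain_edges t c d : uniq (inorder t) ->
    {in right_chain t, forall x, x \in s /\ lp x = left_of t x} ->
    (c, d) \in redges t -> same_block (blocks L') c d.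
  move=> Ut H; rewrite -{1}(link_right_chain Ut (lp := lp)) => [|x /H[]//].
  rewrite redges_link_right mem_cat => /orP[/mem_steps[/H[cs _] /H[ds _]]|].
    exact: ss.
  by case/flattenP=> _ /mapP[x /H[xs _] ->]; apply: inl.
case/orP: ab => [|ab].
  apply: chain_edges => // x xT; rewrite mems xT; split=> //.
  by rewrite /lp (right_chain_mem xT).
case: (redges_replace_at na (link_right lp s) U2 ab); rewrite -?EL'.
- apply: chain_edges => // x xT; rewrite mems xT orbT; split=> //.
  have xT' := right_chain_mem xT.
  have /dis /negPf : x \in inorder T2 by apply: subtree_at_sub xT'.
  by rewrite /lp /= => ->; rewrite /left_of subtree_at_trans.
- exact: redges_same_block.
(* The edge that entered [na] now enters the head of [s], and [na] lies on this same chain. *)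
case=> -> H; have nas : na \in s by rewrite mems Ena mem_head orbT.
case Es : s nas => [//|z s'] nas; rewrite -Es in nas.
have /H/redges_same_block az : root_label (link_right lp s) = Some z by rewrite Es.
apply: same_block_trans az _; first by rewrite uniq_blocks.
by apply: ss => //; rewrite Es mem_head.
Qed.

(** * Trees labeled in preorder *)

Fixpoint preorder t : seq nat :=
  if t is Node l x r then x :: preorder l ++ preorder r else [::].

Lemma perm_preorder t : perm_eq (preorder t) (inorder t).
Proof.
by elim: t => //= l IHl x r IHr; rewrite perm_sym perm_catC /= perm_cons
  perm_catC perm_sym perm_cat.
Qed.

(** The basis of all later label arithmetic: the root has the least label, the left subtree the
    interval after it, and the right subtree the final interval. *)
Lemma preorder_node l x r m k : preorder (Node l x r) = iota m k ->
  exists p q, [/\ x = m, k = (p + q).+1, preorder l = iota m.+1 p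
    & preorder r = iota (m.+1 + p) q].
Proof.
case: k => //= k [-> E]; exists (size (preorder l)), (size (preorder r)).
have Ek : k = size (preorder l) + size (preorder r).
  by rewrite -size_cat E size_iota.
move: E; rewrite Ek iotaD => /eqP; rewrite eqseq_cat ?size_iota //.
by case/andP=> /eqP <- /eqP <-.
Qed.

Section Preordered.

Variables (t : bintree) (m k : nat).
Hypothesis Et : preorder t = iota m k.

Lemma preordered_perm : perm_eq (inorder t) (iota m k).
Proof. by rewrite -Et perm_sym perm_preorder. Qed.

Lemma preordered_mem x : (x \in inorder t) = (m <= x < m + k).
Proof. by rewrite (perm_mem preordered_perm) mem_iota. Qed.

Lemma preordered_uniq : uniq (inorder t).
Proof. by rewrite (perm_uniq preordered_perm) iota_uniq. Qed.

Lemma preordered_root x : root_label t = Some x -> x = m.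
Proof. by case: t Et => // l y r /preorder_node[p [q [-> _ _ _]]] [<-]. Qed.

End Preordered.

Lemma preordered_increasing t m k : preorder t = iota m k -> increasing t.
Proof.
elim: t m k => // l IHl x r IHr m k /preorder_node[p [q [-> _ El Er]]].
have rt u j i y : preorder u = iota j i -> root_label u = Some y -> y = j.
  by move=> /preordered_root; apply.
rewrite /= (IHl _ _ El) (IHr _ _ Er) !andbT.
apply/andP; split.
  by case E: root_label => [y|] //=; rewrite (rt _ _ _ _ El E).
by case E: root_label => [y|] //=; rewrite (rt _ _ _ _ Er E); lia.
Qed.

Lemma preordered_labeled t n : preorder t = iota 1 n -> labeled_tree n t.
Proof.
move=> E; rewrite /labeled_tree (preordered_perm E).
exact: preordered_increasing E.
Qed.

Lemma preordered_subtree t m k x : preorder t = iota m k -> x \in inorder t ->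
  exists j, preorder (subtree_at t x) = iota x j.
Proof.
elim: t m k => // l IHl y r IHr m k E.
have [p [q [Ey _ El Er]]] := preorder_node E.
rewrite [subtree_at _ _]/= [inorder _]/= mem_cat inE.
case: eqVneq => [-> _|_]; first by exists k; rewrite E Ey.
case: ifP => [xl _|_ /= xr]; first exact: IHl El xl.
exact: IHr Er xr.
Qed.

Lemma preorder_replace_at t x u : uniq (inorder t) ->
  preorder u = preorder (subtree_at t x) -> preorder (replace_at t x u) = preorder t.
Proof.
elim: t => // l IHl y r IHr U; have [Ul Ur yl yr lr] := uniq_nodeP U.
rewrite [replace_at _ _ _]/= [subtree_at _ _]/=.
case: ifP => // _; case: ifPn => xl Eu.
  rewrite /= IHl // replace_at_notin //; apply/negP; exact: lr.
by rewrite /= IHr // replace_at_notin.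
Qed.

(** The new subtree keeps the root [x], so the edge entering [x], if any, is counted on both sides.
    The additive form avoids truncated subtraction. *)
Lemma size_redges_replace_at t x u : uniq (inorder t) -> x \in inorder t ->
    root_label u = Some x ->
  size (redges (replace_at t x u)) + size (redges (subtree_at t x)) =
  size (redges t) + size (redges u).
Proof.
move=> + + ru; elim: t => // l IHl y r IHr U; have [Ul Ur yl yr lr] := uniq_nodeP U.
rewrite [replace_at _ _ _]/= [subtree_at _ _]/= [inorder _]/= mem_cat inE.
case: eqVneq => [_ _|_]; first by rewrite addnC.
case: ifPn => xl.
  move=> _; have := IHl Ul xl.
  rewrite [replace_at r _ _]replace_at_notin; last by apply/negP; apply: lr.
  by rewrite /= !size_cat; lia.
move=> /= xr; have := IHr Ur xr; rewrite [replace_at l _ _]replace_at_notin //.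
rewrite /= !size_cat /right_edges_at root_label_replace_at.
by case: eqP => [->|_]; rewrite ?ru /=; clear; lia.
Qed.

Lemma replace_at_trans t x y u : uniq (inorder t) ->
    y \in inorder (subtree_at t x) ->
  replace_at t x (replace_at (subtree_at t x) y u) = replace_at t y u.
Proof.
elim: t => // l IHl z r IHr U; have [Ul Ur zl zr lr] := uniq_nodeP U.
rewrite [subtree_at _ x]/=; case: ifP => xz.
  by rewrite [replace_at _ x _]/= xz.
rewrite [replace_at _ x _]/= xz; case: ifPn => xl ys /=.
  have yl := subtree_at_sub ys; rewrite IHl //.
  rewrite ![replace_at r _ _]replace_at_notin; try by apply/negP; apply: lr.
  by case: eqP => // E; rewrite -E yl in zl.
have yr := subtree_at_sub ys; rewrite IHr //.
rewrite [replace_at l x _]replace_at_notin //.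
rewrite [replace_at l y _]replace_at_notin; last by apply/negP => /lr /(_ yr).
by case: eqP => // E; rewrite -E yr in zr.
Qed.

Lemma replace_at_replace t x v u : root_label v = Some x ->
  replace_at (replace_at t x v) x u = replace_at t x u.
Proof.
case: v => // lv z rv [->]; elim: t => //= l IHl y r IHr.
case: eqVneq => [_|xy] /=; first by rewrite eqxx.
by rewrite (negPf xy) IHl IHr.
Qed.

Lemma subtree_at_replace t x v : uniq (inorder t) -> x \in inorder t ->
  root_label v = Some x -> subtree_at (replace_at t x v) x = v.
Proof.
case: v => // lv z rv + + [->].
set v := Node lv x rv => /=; have xv : x \in inorder v by rewrite mem_cat inE eqxx orbT.
elim: t => // l IHl y r IHr U; have [Ul Ur yl yr lr] := uniq_nodeP U.
rewrite /= mem_cat inE; case: eqVneq => [_ _|xy /=].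
  by rewrite /v /= eqxx.
rewrite (negPf xy); case: (boolP (x \in inorder l)) => [xl _|xl /= xr].
  have [w1 [w2 [_ ->]]] := inorder_replace_at Ul xl.
  by rewrite mem_cat [x \in inorder v ++ _]mem_cat xv orbT IHl.
by rewrite [replace_at l _ _]replace_at_notin // (negPf xl) IHr.
Qed.

Lemma root_path_mem t x y : uniq (inorder t) ->
  y \in inorder (subtree_at t x) -> x \in root_path t y.
Proof.
elim: t => // l IHl z r IHr U; have [Ul Ur zl zr lr] := uniq_nodeP U.
rewrite [subtree_at _ x]/=; case: eqVneq => [->|xz].
  rewrite /= mem_cat inE; case: eqP => [_ _|_ /=]; first by rewrite mem_head.
  by case: ifP => [_ _|_ /= ->]; rewrite mem_head.
case: ifPn => xl ys /=.
  have yl := subtree_at_sub ys; rewrite yl.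
  case: eqP => [E|_]; first by rewrite -E yl in zl.
  by rewrite inE IHl ?orbT.
have yr := subtree_at_sub ys; rewrite yr.
case: eqP => [E|_]; first by rewrite -E yr in zr.
by case: ifP => [/lr /(_ yr) //|_]; rewrite inE IHr ?orbT.
Qed.

(** Used to produce the parent [n0] of a rotation: a node that is neither the root nor a right child
    is a left child. *)
Lemma parentP t x : uniq (inorder t) -> x \in inorder t ->
  [\/ root_label t = Some x, exists y, (y, x) \in redges t
    | exists y, left_child t y = Some x].
Proof.
elim: t => // l IHl z r IHr U; have [Ul Ur zl zr lr] := uniq_nodeP U.
have lc y : y \in inorder l -> left_child (Node l z r) y = left_child l y.
  move=> yl; rewrite /left_child /left_of /= yl.
  by case: eqP => // E; rewrite -E yl in zl.
have rc y : y \in inorder r -> left_child (Node l z r) y = left_child r y.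
  move=> yr; rewrite /left_child /left_of /=.
  case: eqP => [E|_]; first by rewrite -E yr in zr.
  by case: ifP => // /lr /(_ yr).
have dom u y : left_child u y = Some x -> y \in inorder u.
  move=> E; apply/negPn/negP => yu.
  by rewrite /left_child /left_of subtree_at_notin in E.
rewrite /= mem_cat inE; case/or3P=> [xl|/eqP->|xr]; last 2 first.
- by constructor 1.
- case: (IHr Ur xr) => [E|[y xy]|[y yx]].
  + by constructor 2; exists z; rewrite !mem_cat mem_right_edges ?orbT.
  + by constructor 2; exists y; rewrite !mem_cat xy !orbT.
  + by constructor 3; exists y; rewrite rc // (dom _ _ yx).
case: (IHl Ul xl) => [E|[y xy]|[y yx]].
+ by constructor 3; exists z; rewrite /left_child /left_of /= eqxx.
+ by constructor 2; exists y; rewrite !mem_cat xy.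
+ by constructor 3; exists y; rewrite lc // (dom _ _ yx).
Qed.

(** * Attaching a tree at the lower end of a right chain *)

Fixpoint graft t u : bintree :=
  if t is Node l x r then Node l x (graft r u) else u.

Lemma preorder_graft t u : preorder (graft t u) = preorder t ++ preorder u.
Proof. by elim: t => //= l _ x r ->; rewrite catA. Qed.

(** The extra unit is the edge at the junction. *)
Lemma size_redges_graft t u : t <> Empty -> u <> Empty ->
  size (redges (graft t u)) = (size (redges t) + size (redges u)).+1.
Proof.
elim: t => // l _ x [|lr y rr] IHr _ u0.
  by case: u u0 {IHr} => //= lu z ru _; rewrite !size_cat /= !size_cat /=; lia.
have E : size (redges (graft (Node lr y rr) u)) =
  (size (redges (Node lr y rr)) + size (redges u)).+1 by apply: IHr.
change (size (redges l ++ (x, y) :: redges (graft (Node lr y rr) u)) =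
  (size (redges l ++ (x, y) :: redges (Node lr y rr)) + size (redges u)).+1).
move: E; move: (redges (graft _ u)) (redges (Node lr y rr)) => A B E.
by rewrite !size_cat /=; lia.
Qed.

Lemma graft_empty t : graft t Empty = t.
Proof. by elim: t => //= l _ x r ->. Qed.

Lemma link_right_cat lp s s' :
  link_right lp (s ++ s') = graft (link_right lp s) (link_right lp s').
Proof. by elim: s => //= x s ->. Qed.

Lemma right_chain_subseq t : subseq (right_chain t) (preorder t).
Proof.
elim: t => //= l _ x r IHr; rewrite eqxx.
exact: subseq_trans IHr (suffix_subseq _ _).
Qed.

(** * Rotating a whole left subtree *)

Lemma m_select_iota L n (P : pred nat) :
  {in iota 1 (m_length L n), P =1 predT} -> m_select L n P = behead (m_chain L n).
Proof.
move=> H; rewrite /m_select (eq_in_filter H) filter_predT.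
rewrite map_nth_iota; last by rewrite subn1.
by rewrite drop1 take_oversize // size_behead.
Qed.

(** In preorder the labels to the left of a node are below those to its right. Hence every element
    of [LS] is an admissible choice of [na]. *)
Lemma smaller_right_nil t m k n : preorder t = iota m k -> smaller_right t n = [::].
Proof.
move=> E; apply/eqP; rewrite -[_ == _]negbK -has_filter; apply/hasPn => x _.
apply/negP => /andP[xn /hasP[c ct /andP[]]]; rewrite /right_of /left_of.
have [j Ej] := preordered_subtree E ct.
have [l [r Ec]] := subtree_atP ct; rewrite Ec in Ej *.
have [p [q [_ _ El Er]]] := preorder_node Ej.
by rewrite /= (preordered_mem El) (preordered_mem Er); lia.
Qed.

(** The rotation that moves the left chain below [n] entirely: the subtree of [n] becomes the right
    child of [a], and the former right subtree of [a] continues the right chain of [n]. *)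
Definition rotate t n a : bintree :=
  replace_at t a (Node (replace_at (left_of t a) n Empty) a
                       (graft (subtree_at t n) (right_of t a))).

Lemma left_of_mem t a n : n \in inorder (left_of t a) -> a \in inorder t.
Proof.
by move=> H; apply/negPn/negP => at'; rewrite /left_of subtree_at_notin in H.
Qed.

Lemma right_chain_sorted t m k : preorder t = iota m k -> pairwise ltn (right_chain t).
Proof.
move=> E; apply: subseq_pairwise (right_chain_subseq t) _.
by rewrite E -sorted_pairwise ?iota_ltn_sorted //; apply: ltn_trans.
Qed.

(** In preorder the labels of the moved subtree lie between [a] and the labels to the right of [a],
    so the sorted merge of the two chains is an insertion right after [a]. *)
Lemma rotate_is_rotation t m k n a : preorder t = iota m k ->
    n \in inorder (left_of t a) -> (forall x, (x, n) \notin redges t) ->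
  is_rotation t (rotate t n a).
Proof.
move=> Et nla Hn; have at_ := left_of_mem nla.
have U := preordered_uniq Et.
have [l [r Ea]] := subtree_atP at_.
have Ela : left_of t a = l by rewrite /left_of Ea.
have Era : right_of t a = r by rewrite /right_of Ea.
rewrite Ela in nla.
have [j Ej] := preordered_subtree Et at_; rewrite Ea in Ej.
have [p [q [_ _ El Er]]] := preorder_node Ej.
have ltl x : x \in inorder l -> a < x.
  by rewrite (preordered_mem El) => /andP[].
have llr x y : x \in inorder l -> y \in inorder r -> x < y.
  rewrite (preordered_mem El) (preordered_mem Er) => /andP[_ xp] /andP[py _].
  exact: leq_trans xp py.
have ltr x : x \in inorder r -> a < x.
  by move/(llr _ _ nla); apply: ltn_trans (ltl _ nla).
have an := ltl _ nla; have na := gtn_eqF an.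
have nsa : n \in inorder (subtree_at t a) by rewrite Ea /= mem_cat nla.
have nt := subtree_at_sub nsa.
have Enl : subtree_at t n = subtree_at l n.
  by rewrite -(subtree_at_trans U nsa) Ea /= na nla.
(* The root has the least label [m], and [m <= a < n]; so [n] is not the root, and by hypothesis it
   is not a right child. *)
have [n0 Ln0] : exists n0, left_child t n0 = Some n.
  case: (parentP U nt) => [/(preordered_root Et) nm|[x xn]|//].
    by move: at_; rewrite (preordered_mem Et) -nm; lia.
  by have := Hn x; rewrite xn.
have [ln [rn [r' [En0 En]]]] := left_child_subtree U Ln0.
have Mc : m_chain t n = left_chain (subtree_at t n) by [].
have [jn EX] := preordered_subtree Et nt.
have UX := subtree_at_uniq n U.
(* S is everything: the left chain below n moves along with n. *)
exists n, n0, a, (iota 1 (m_length t n)); split => //.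
(* Membership of [a] in [LS]: its left child is the root of [l], which lies on the path to [n]. *)
- rewrite /admissible_na (smaller_right_nil n Et) andbT mem_filter.
  rewrite root_path_mem // andbT neq_ltn an /= /left_child Ela.
  have lsub : {subset inorder l <= inorder (subtree_at t a)}.
    by move=> x xl; rewrite Ea /= mem_cat xl.
  case El' : l nla => [//|l1 y l2] nla /=; rewrite -El' in nla.
  have ysa : y \in inorder (subtree_at t a).
    by apply: lsub; rewrite El' /= mem_cat inE eqxx orbT.
  apply: root_path_mem => //; rewrite -(subtree_at_trans U ysa) Ea.
  have yl : y \in inorder l by rewrite El' /= mem_cat inE eqxx orbT.
  have ya := gtn_eqF (ltl _ yl).
  by rewrite /= ya yl El' /= eqxx -[inorder _]/(inorder (Node l1 y l2)) -El'.
- by apply/allP => i; rewrite mem_iota add1n ltnS.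
have T1 : tree1 t n (iota 1 (m_length t n)) = subtree_at t n.
  rewrite /tree1 m_select_iota => [|i ->//].
  have -> : n :: behead (m_chain t n) = left_chain (subtree_at t n).
    by rewrite /m_chain En.
  by apply: link_left_chain => // x /(right_of_left_chain U).
(* No [m_i] is retained, so [n0] loses its left child, and this deletes the subtree of [n]. *)
have T2 : tree2 t n n0 (iota 1 (m_length t n)) = replace_at t n Empty.
  rewrite /tree2 /m_select (@eq_in_filter _ _ pred0) => [|i /= ->//].
  rewrite filter_pred0 /=.
  have nn0 : n \in inorder (subtree_at t n0).
    by rewrite En0 /= !mem_cat inE eqxx !orbT.
  rewrite -(replace_at_trans _ U nn0) En0 /right_of En0 /=.
  have := subtree_at_uniq n0 U; rewrite En0 => /uniq_nodeP[_ _ n0n _ nr'].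
  have nX : n \in inorder (Node ln n rn) by rewrite /= mem_cat inE eqxx orbT.
  rewrite eqxx [replace_at r' _ _]replace_at_notin; last by apply/negP => H; exact: nr' nX H.
  by case: eqP => // E; rewrite -E nX in n0n.
set l' := replace_at l n Empty.
have nr : n \notin inorder r.
  by apply/negP => /(llr _ _ nla); rewrite ltnn.
have T2' : replace_at t n Empty = replace_at t a (Node l' a r).
  by rewrite -(replace_at_trans _ U nsa) Ea /= na (replace_at_notin _ nr).
have T2a : subtree_at (replace_at t n Empty) a = Node l' a r.
  by rewrite T2' subtree_at_replace.
have UT2 : uniq (inorder (replace_at t n Empty)).
  have [v [w [Ev ->]]] := inorder_replace_at U nt.
  apply: subseq_uniq U; rewrite Ev.
  by apply: cat_subseq => //; apply: cat_subseq => //; apply: sub0seq.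
have memX x : x \in inorder (subtree_at t n) -> x \in inorder l.
  by rewrite Enl; apply: subtree_at_sub.
rewrite /glue T1 T2 T2a.
rewrite subtree_at_trans //; last by rewrite En /= mem_cat inE eqxx orbT.
set X := subtree_at t n; set lp := fun x : nat => _.
(* The labels of [X] come from [l], hence are above [a] and below those of [r]: sorting only brings
   [a] to the front. *)
have -> : sort leq (right_chain X ++ right_chain (Node l' a r)) =
    a :: right_chain X ++ right_chain r.
  apply: (sorted_eq leq_trans anti_leq (sort_sorted leq_total _)); last first.
    by rewrite perm_sort /= -(cat1s a (right_chain r)) perm_catCA.
  rewrite (sorted_pairwise leq_trans); apply: (sub_pairwise (r := ltn)) => [x y /ltnW//|].
  rewrite /= pairwise_cat (right_chain_sorted EX) (right_chain_sorted Er) andbT andbT.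
  apply/andP; split.
    by apply/allP => x; rewrite mem_cat => /orP[|] /right_chain_mem => [/memX/ltl|/ltr].
  by apply/allrelP => x y /right_chain_mem/memX + /right_chain_mem; apply: llr.
rewrite /= link_right_cat.
have lpX x : x \in inorder X -> lp x = left_of X x by rewrite /lp => ->.
have lpN x : x \notin inorder X -> lp x = left_of (replace_at t n Empty) x.
  by rewrite /lp => /negPf->.
rewrite link_right_chain => [|//|x /right_chain_mem /lpX//].
have aX : a \notin inorder X.
  by apply/negP => /memX/ltl; rewrite ltnn.
have -> : lp a = l' by rewrite lpN // /left_of T2a.
rewrite link_right_chain => [| |x /right_chain_mem xr].
- rewrite T2' replace_at_replace // /rotate Ela Era; congr replace_at.
- exact: preordered_uniq Er.
have xX : x \notin inorder X.
  by apply/negP => /memX/llr/(_ xr); rewrite ltnn.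
rewrite lpN // /left_of -(subtree_at_trans (x := a) UT2) T2a; last first.
  by rewrite /= mem_cat inE xr !orbT.
have l'l : {subset inorder l' <= inorder l}.
  have [v [w [-> ]]] := inorder_replace_at (preordered_uniq El) nla.
  by rewrite /l' => -> y /=; rewrite !mem_cat => /orP[->|->]; rewrite ?orbT.
have xl' : (x \in inorder l') = false.
  by apply/negP => /l'l/llr/(_ xr); rewrite ltnn.
by rewrite /= xl' (gtn_eqF (ltr _ xr)).
Qed.

(** * Noncrossing equivalences *)

Lemma redges_detach t x : {subset redges (replace_at t x Empty) <= redges t}.
Proof.
elim: t => //= l IHl y r IHr e; case: ifP => //= _.
rewrite !mem_cat => /or3P[/IHl->//|H|/IHr->]; rewrite ?orbT //.
move: H; rewrite /right_edges_at root_label_replace_at.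
by case: ifP => // _ ->; rewrite orbT.
Qed.

Lemma redges_subtree_at t x : {subset redges (subtree_at t x) <= redges t}.
Proof.
elim: t => //= l IHl y r IHr e; case: ifP => //= _.
by case: ifP => _ H; rewrite !mem_cat ?(IHl _ H) ?(IHr _ H) ?orbT.
Qed.

Lemma redges_replace_at_sub t x u e : root_label u = Some x ->
  e \in redges (replace_at t x u) -> e \in redges t \/ e \in redges u.
Proof.
move=> ru; elim: t => [|l IHl y r IHr]; [by left|].
rewrite /=; case: ifP => _; [by right|].
rewrite /= !mem_cat /right_edges_at root_label_replace_at ru.
rewrite (_ : (if _ then _ else _) = root_label r); last by case: eqP => [->|].
by case/or3P=> [/IHl[]|->|/IHr[]] => [->|->||->|->]; rewrite ?orbT; auto.
Qed.

(** No right edge enters [x], so the removal loses exactly the right edges inside the subtree. *)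
Lemma size_redges_detach t x : uniq (inorder t) -> x \in inorder t ->
    (forall y, (y, x) \notin redges t) ->
  size (redges (replace_at t x Empty)) + size (redges (subtree_at t x)) =
  size (redges t).
Proof.
elim: t => // l IHl y r IHr U; have [Ul Ur yl yr lr] := uniq_nodeP U.
rewrite [replace_at _ _ _]/= [subtree_at _ _]/= [inorder _]/= mem_cat inE.
move=> + H.
have Hl z : (z, x) \notin redges l.
  by apply: contra (H z); rewrite !mem_cat => ->.
have Hr z : (z, x) \notin redges r.
  by apply: contra (H z); rewrite !mem_cat => ->; rewrite !orbT.
case: eqVneq => //= _.
case: ifPn => /= [xl _|xl xr].
  rewrite [replace_at r _ _]replace_at_notin; last by apply/negP; apply: lr.
  by rewrite !size_cat -(IHl Ul xl Hl); lia.
rewrite [replace_at l _ _]replace_at_notin // !size_cat -(IHr Ur xr Hr).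
rewrite /right_edges_at root_label_replace_at; case: eqP => [E|_]; last by lia.
by have := H y; rewrite /= !mem_cat mem_right_edges ?orbT.
Qed.

(** Bounds the number of rotations below, each of which adds a right edge. *)
Lemma size_redges_le t : size (redges t) <= size (inorder t).
Proof.
(* Strengthened for the induction: the root of a nonempty right subtree leaves one unit of room for
   the edge from its parent. *)
suff H : size (redges t) + (root_label t != None) <= size (inorder t).
  exact: leq_trans (leq_addr _ _) H.
elim: t => //= l IHl x r IHr; rewrite !size_cat /=.
by move: IHl IHr; rewrite /right_edges_at; case: (root_label r) => /=; lia.
Qed.

Lemma redges_lt t m k x y : preorder t = iota m k -> (x, y) \in redges t -> x < y.
Proof.
elim: t m k => // l IHl z r IHr m k /preorder_node[p [q [-> _ El Er]]].
rewrite /= !mem_cat => /or3P[/(IHl _ _ El)//|/right_edges_atP[->]|/(IHr _ _ Er)//].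
by move/(preordered_root Er) ->; lia.
Qed.

Section NoncrossingEquivalence.

Variable E : rel nat.
Hypotheses (symE : symmetric E) (transE : transitive E).
Hypothesis ncE :
  forall a b c d, a < b -> b < c -> c < d -> E a c -> E b d -> E a b.

(** By transitivity of [E], any two consecutive or more distant entries of a right chain are then
    related. *)
Definition compatible t := forall x y, (x, y) \in redges t -> E x y.

Lemma compatible_root l x r y :
  compatible (Node l x r) -> root_label r = Some y -> E x y.
Proof. by move=> H ry; apply: H; rewrite /= !mem_cat mem_right_edges ?orbT. Qed.

Lemma compatible_left l x r : compatible (Node l x r) -> compatible l.
Proof. by move=> H a b ab; apply: H; rewrite /= !mem_cat ab. Qed.

Lemma compatible_right l x r : compatible (Node l x r) -> compatible r.
Proof. by move=> H a b ab; apply: H; rewrite /= !mem_cat ab !orbT. Qed.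

Lemma compatible_graft t u : compatible t -> compatible u ->
    (forall x y, root_label t = Some x -> root_label u = Some y -> E x y) ->
  compatible (graft t u).
Proof.
elim: t => //= l _ x r IHr ct cu H a b; rewrite /= !mem_cat => /or3P[ab|ab|].
- exact: compatible_left ct _ _ ab.
- case/right_edges_atP: ab => ->; case: r {IHr} ct => /= [_|lr y rr ct [<-]].
    exact: H.
  exact: compatible_root ct _.
apply: IHr => // [|y z ry uz]; first exact: compatible_right ct.
apply: (@transE x); last by apply: H.
by rewrite symE; apply: compatible_root ct ry.
Qed.

(** The subtree of [n] is the end of the preorder. If the path to [n] went left at a node [y] with a
    right child [z], then [a < y < n < z] with [E a n] and [E y z]; noncrossing gives [E a y],
    against the choice of [a]. *)
Lemma preorder_detach t m k a n : preorder t = iota m k -> compatible t ->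
    n \in inorder t -> a < m -> E a n -> (forall c, a < c < n -> ~~ E a c) ->
  preorder (replace_at t n Empty) ++ preorder (subtree_at t n) = preorder t.
Proof.
move=> + + + am Ean Hmax; elim: t m k am => // l IHl y r IHr m k am Et.
have U := preordered_uniq Et; have [Ul Ur yl yr lr] := uniq_nodeP U.
have [p [q [Ey Ek El Er]]] := preorder_node Et.
move=> ct; rewrite [replace_at _ _ _]/= [subtree_at _ _]/= [inorder _]/= mem_cat inE.
case: eqVneq => //= _; case: ifPn => /= [nl _|nl nr].
  rewrite [replace_at r _ _]replace_at_notin; last by apply/negP; apply: lr.
  case Er' : r => [|lr' z rr].
    by rewrite /= !cats0 (IHl _ _ _ El) //; [lia|exact: compatible_left ct].
  have rz : root_label r = Some z by rewrite Er'.
  have Eyz := compatible_root ct rz.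
  have Ez := preordered_root Er rz.
  have := nl; rewrite (preordered_mem El) => nlt.
  have Eay : E a y by apply: (@ncE a y n z) => //; lia.
  have : ~~ E a y by apply: Hmax; lia.
  by rewrite Eay.
rewrite [replace_at l _ _]replace_at_notin // -catA (IHr _ _ _ Er) //.
- by lia.
- exact: compatible_right ct.
Qed.

(** Climbing a right edge decreases the label, so the climb ends at a node that is not a right
    child. The relation [E] may fail to be reflexive, hence the alternative [z == x]. *)
Lemma top_of_chain t m k x : preorder t = iota m k -> compatible t ->
    x \in inorder t ->
  exists z, [/\ same_block (blocks t) z x, (z == x) || E z x, z \in inorder t
    & forall y, (y, z) \notin redges t].
Proof.
move=> Et ct; have [b] := ubnP x; elim: b x => // b IH x xb xt.
case: (boolP (has (fun e => e.2 == x) (redges t))) => [/hasP[[w x'] wx /= /eqP Ex]|/hasPn H].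
  rewrite {}Ex in wx; have wlt := redges_lt Et wx.
  have [wt _] := redges_mem wx.
  have [z [zw Ezw zt Hz]] := IH w (leq_trans wlt xb) wt.
  exists z; split=> //.
    apply: same_block_trans zw (redges_same_block wx).
    by rewrite uniq_blocks (preordered_uniq Et).
  apply/orP; right; case/orP: Ezw => [/eqP->|Ezw]; first exact: ct.
  exact: transE Ezw (ct _ _ wx).
exists x; split; rewrite ?eqxx -?same_block_refl ?mem_blocks // => y.
by apply/negP => /H; rewrite eqxx.
Qed.

(** In each bad position, namely [n] to the right of [a] or the two separated by a node with [n] on
    its right, the right child [z] of the separating node satisfies [a < z < n] and [E a z], against
    the choice of [a]. *)
Lemma left_of_closest t m k a n : preorder t = iota m k -> compatible t ->
    n \in inorder t -> a \in inorder t -> a < n -> E a n ->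
    (forall c, a < c < n -> ~~ E a c) -> (forall x, (x, n) \notin redges t) ->
  n \in inorder (left_of t a).
Proof.
move=> + + + + an Ean Hmax; elim: t m k => // l IHl x r IHr m k Et ct.
have [p [q [Ex Ek El Er]]] := preorder_node Et => nt at_ Hn.
have inl v : (v \in inorder l) = (m < v < m.+1 + p) by rewrite (preordered_mem El).
have inr v : (v \in inorder r) = (m.+1 + p <= v < m.+1 + p + q).
  by rewrite (preordered_mem Er).
have Hl z : (z, n) \notin redges l.
  by apply: contra (Hn z); rewrite !mem_cat => ->.
have Hr z : (z, n) \notin redges r.
  by apply: contra (Hn z); rewrite !mem_cat => ->; rewrite !orbT.
have nlr : (n \in inorder l) || (n \in inorder r).
  by move: nt at_; rewrite (preordered_mem Et) (preordered_mem Et) inl inr; lia.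
(* The inequality [z < n] is strict because [n] is not a right child, so it is not the root of
   [r]. *)
have rooted : n \in inorder r -> exists2 z, E x z & m.+1 + p = z /\ z < n.
  move=> nr; case Er' : r nr => [//|lr z rr] nr; rewrite -Er' in nr.
  have rz : root_label r = Some z by rewrite Er'.
  exists z; first exact: compatible_root ct rz.
  have zE := preordered_root Er rz; split=> //.
  rewrite ltn_neqAle; apply/andP; split; last by move: nr; rewrite inr -zE; lia.
  apply/eqP => zn; have := Hn x; rewrite /= !mem_cat mem_right_edges ?orbT //.
  by rewrite -zn.
rewrite /left_of /=; case: eqVneq => [ax|ax] /=.
  case/orP: nlr => // /rooted[z Exz [zE zn]].
  by have := Hmax z; rewrite ax Exz => /(_ _)/negP; case=> //; lia.
case: ifPn => al.
  apply: (IHl _ _ El) => //; first exact: compatible_left ct.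
  case/orP: nlr => // /rooted[z Exz [zE zn]].
  have := al; rewrite (inl a) => alt.
  (* The crossing pairs are [(x, z)] and [(a, n)], with [x < a < z < n]. *)
  have Exa : E x a by apply: (@ncE x a z n) => //; lia.
  have Eaz : E a z by apply: transE Exz; rewrite symE.
  have : ~~ E a z by apply: Hmax; lia.
  by rewrite Eaz.
have ar : a \in inorder r.
  by move: at_ ax al; rewrite (preordered_mem Et) inl inr; lia.
apply: (IHr _ _ Er) => //; first exact: compatible_right ct.
by move: nlr ar; rewrite inl !inr; lia.
Qed.

Lemma rotate_closest t m k a n : preorder t = iota m k -> compatible t ->
    n \in inorder t -> a \in inorder t -> a < n -> E a n ->
    (forall c, a < c < n -> ~~ E a c) -> (forall x, (x, n) \notin redges t) ->
  [/\ preorder (rotate t n a) = preorder t, compatible (rotate t n a),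
      size (redges (rotate t n a)) = (size (redges t)).+1
    & is_rotation t (rotate t n a)].
Proof.
move=> Et ct nt at_ an Ean Hmax Hn.
have nla := left_of_closest Et ct nt at_ an Ean Hmax Hn.
have rot := rotate_is_rotation Et nla Hn.
have U := preordered_uniq Et.
have [l [r Ea]] := subtree_atP at_.
have Ela : left_of t a = l by rewrite /left_of Ea.
have Era : right_of t a = r by rewrite /right_of Ea.
rewrite Ela in nla.
have [j Ej] := preordered_subtree Et at_; rewrite Ea in Ej.
have [p [q [_ _ El Er]]] := preorder_node Ej.
have na : (n == a) = false by apply/negbTE; rewrite neq_ltn an orbT.
have nsa : n \in inorder (subtree_at t a) by rewrite Ea /= mem_cat nla.
have Enl : subtree_at t n = subtree_at l n.
  by rewrite -(subtree_at_trans U nsa) Ea /= na nla.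
have csa : compatible (Node l a r).
  by move=> x y; rewrite -Ea => /redges_subtree_at; apply: ct.
have cl := compatible_left csa; have cr := compatible_right csa.
have [lX [rX EX]] := subtree_atP nla.
have Hl z : (z, n) \notin redges l.
  apply: contra (Hn z) => zn; apply: (@redges_subtree_at _ a).
  by rewrite Ea /= mem_cat zn.
rewrite /rotate Ela Era Enl in rot *; set u := Node _ a _ in rot *.
have ru : root_label u = Some a by [].
split=> //.
- rewrite preorder_replace_at // Ea /= preorder_graft catA.
  by rewrite (preorder_detach (a := a) El).
- move=> x y /(redges_replace_at_sub ru)[]; first exact: ct.
  rewrite /= !mem_cat => /or3P[/redges_detach|/right_edges_atP[->]|].
  + exact: cl.
  + by rewrite EX /= => -[<-].
  apply: compatible_graft => // [b c /redges_subtree_at|b c]; first exact: cl.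
  rewrite EX /= => -[<-] rc; apply: (@transE a); first by rewrite symE.
  exact: compatible_root csa rc.
have := size_redges_replace_at U at_ ru; rewrite Ea.
have := size_redges_detach (preordered_uniq El) nla Hl.
set G := graft (subtree_at l n) r; have rG : root_label G = Some n by rewrite /G EX.
(* The junction edge of the graft exists exactly when [a] had a right child, so it makes up for the
   edge lost there; the new edge from [a] to [n] is the net gain. *)
have sG : size (redges G) =
    size (redges (subtree_at l n)) + size (redges r) + size (right_edges_at a r).
  rewrite /G; case: (r) => [|lr z rr]; first by rewrite graft_empty /= !addn0.
  by rewrite size_redges_graft ?EX // addn1.
have -> : size (redges u) = size (redges (replace_at l n Empty)) + 1 + size (redges G).
  by rewrite [redges u]/= -/G !size_cat /right_edges_at rG addnA.
rewrite [redges (Node l a r)]/= !size_cat sG.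
by move: (size _) (size _) (size _) (size _) (size _) (size _) (size _) => *; lia.
Qed.

(** Both ends are kept in preorder, so that each intermediate tree is again a labeled tree on the
    same labels. *)
Definition tree_step n t t' : Prop :=
  [/\ preorder t = iota 1 n, preorder t' = iota 1 n & is_rotation t t'].

Lemma rotate_to_equivalence n t : preorder t = iota 1 n -> compatible t ->
  exists t', [/\ clos_refl_trans _ (tree_step n) t t', preorder t' = iota 1 n,
    compatible t' & forall x y, x \in inorder t' -> y \in inorder t' -> E x y ->
      same_block (blocks t') x y].
Proof.
(* Each rotation adds one right edge, and there are never more than [n]. *)
have [b] := ubnP (n - size (redges t)); elim: b t => // b IH t tb Et ct.
case: (boolP (all (fun x => all (fun y => E x y ==> same_block (blocks t) x y)
    (inorder t)) (inorder t))) => [/allP H|/allPn[x xt /allPn[y yt]]].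
  exists t; split=> // [|x y /H/allP {}H /H/implyP//]; exact: rt_refl.
rewrite negb_imply => /andP[Exy /negP nsb].
have UB : uniq (flatten (blocks t)) by rewrite uniq_blocks (preordered_uniq Et).
(* The two labels are replaced by the tops of their chains, because the node to be moved must not be
   a right child. The larger top will move. *)
have [v [vx Evx vt Hv]] := top_of_chain Et ct xt.
have [w [wy Ewy wt Hw]] := top_of_chain Et ct yt.
have vw : v != w.
  apply/eqP => vw; apply: nsb; apply: same_block_trans wy => //.
  by rewrite same_block_sym -vw.
have Evw : E v w.
  have Evy : E v y by case/orP: Evx => [/eqP->//|/transE]; apply.
  by case/orP: Ewy => [/eqP->//|]; rewrite symE; apply: transE.
have [n' [a' [nt at_ an Ean Hn]]] : exists n' a', [/\ n' \in inorder t,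
    a' \in inorder t, a' < n', E a' n' & forall x, (x, n') \notin redges t].
  move: vw; rewrite neq_ltn => /orP[vw|wv]; first by exists w, v.
  by exists v, w; split=> //; rewrite symE.
have [a /andP[an2 Ean2] amax] := ex_maxnP (ex_intro (fun c => (c < n') && E c n') a'
  (introT andP (conj an Ean))) (m := n') (fun c H => ltnW (proj1 (andP H))).
have a'a : a' <= a by apply: amax; rewrite an.
have Ha c : a < c < n' -> ~~ E a c.
  case/andP=> ac cn; apply/negP => Eac.
  have /amax : (c < n') && E c n'.
    by rewrite cn; apply: transE Ean2; rewrite symE.
  by rewrite leqNgt ac.
(* The labels form an interval, and [a' <= a < n']. *)
have at2 : a \in inorder t.
  move: at_ nt; rewrite (preordered_mem Et) (preordered_mem Et) (preordered_mem Et).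
  by clear - a'a an2; lia.
have [P C S R] := rotate_closest Et ct nt at2 an2 Ean2 Ha Hn.
have P' : preorder (rotate t n' a) = iota 1 n by rewrite P.
have sl := size_redges_le (rotate t n' a).
rewrite (perm_size (preordered_perm P')) size_iota S in sl.
have [||//|t' [T P2 C2 H2]] := IH (rotate t n' a); rewrite ?S //.
  by clear - tb sl; lia.
exists t'; split=> //; apply: rt_trans T; apply: rt_step; split=> //.
Qed.

End NoncrossingEquivalence.

(** * Words and trees *)

(* Increasing trees store the right spine in increasing order, so that appending
   a letter to the word cuts the spine below the last smaller label. *)
Fixpoint insert_last t x : bintree :=
  if t is Node l y r then
    if y < x then Node l y (insert_last r x) else Node t x Empty
  else Node Empty x Empty.

(** On words with distinct letters this is the inverse of the in-order bijection [phi]. *)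
Definition tree_of_word w : bintree := foldl insert_last Empty w.

Lemma inorder_insert_last t x : inorder (insert_last t x) = rcons (inorder t) x.
Proof.
elim: t => //= l _ y r IHr; case: ifP => _ /=; first by rewrite IHr rcons_cat.
by rewrite cats1.
Qed.

Lemma inorder_tree_of_word w : inorder (tree_of_word w) = w.
Proof.
rewrite /tree_of_word -[RHS]cat0s -[X in X ++ _]/(inorder Empty).
elim: w Empty => [|x w IH] t /=; first by rewrite cats0.
by rewrite IH inorder_insert_last cat_rcons.
Qed.

Lemma increasing_insert_last t x : increasing t -> x \notin inorder t ->
  increasing (insert_last t x).
Proof.
elim: t => //= l _ y r IHr /and4P[lp rp il ir].
rewrite mem_cat inE !negb_or => /and3P[_ xy xr]; case: ltnP => [yx|xley] /=.
  rewrite lp il IHr //= !andbT.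
  case: r rp {IHr ir xr} => //= lr z rr yz.
  by case: ifP.
by rewrite lp rp il ir ltn_neqAle xy xley.
Qed.

Lemma increasing_tree_of_word w : uniq w -> increasing (tree_of_word w).
Proof.
rewrite /tree_of_word -[X in uniq X]cat0s -[X in X ++ _]/(inorder Empty).
have : increasing Empty by [].
elim: w Empty => [|x w IH] t //= it; rewrite -cat_rcons -inorder_insert_last => U.
apply: IH => //; apply: increasing_insert_last => //.
move: U; rewrite inorder_insert_last cat_rcons cat_uniq /= negb_or.
by case/and3P=> _ /andP[].
Qed.

Lemma increasing_lt l x r y : increasing (Node l x r) ->
  (y \in inorder l) || (y \in inorder r) -> x < y.
Proof.
suff H t : increasing t -> oapp (ltn x) true (root_label t) -> y \in inorder t -> x < y.
  by case/and4P=> lp rp il ir /orP[]; apply: H.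
elim: t => //= l' IHl z r' IHr /and4P[lp rp il ir] xz.
rewrite mem_cat inE => /or3P[|/eqP->//|].
  by apply: IHl => //; case: (root_label l') lp => //= v; apply: ltn_trans.
by apply: IHr => //; case: (root_label r') rp => //= v; apply: ltn_trans.
Qed.

(** The root is the least letter of the word and occurs once, so the word determines it and the
    words of both subtrees. *)
Lemma increasing_inj t t' : uniq (inorder t) -> increasing t -> increasing t' ->
  inorder t = inorder t' -> t = t'.
Proof.
elim: t t' => [|l IHl x r IHr] [|l' x' r'] // U it it' E.
- by move/(congr1 size): E; rewrite /= size_cat addnS.
- by move/(congr1 size): E; rewrite /= size_cat addnS.
have U' : uniq (inorder (Node l' x' r')) by rewrite -E.
have [Ul Ur xl xr _] := uniq_nodeP U; have [Ul' Ur' xl' xr' _] := uniq_nodeP U'.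
have xx' : x = x'.
  have lo y : y \in inorder (Node l x r) -> x <= y.
    rewrite /= mem_cat inE orbCA => /orP[/eqP->//|].
    by move/(increasing_lt it)/ltnW.
  have lo' y : y \in inorder (Node l' x' r') -> x' <= y.
    rewrite /= mem_cat inE orbCA => /orP[/eqP->//|].
    by move/(increasing_lt it')/ltnW.
  have xt : x \in inorder (Node l' x' r') by rewrite -E /= mem_cat inE eqxx orbT.
  have xt' : x' \in inorder (Node l x r) by rewrite E /= mem_cat inE eqxx orbT.
  by apply/eqP; rewrite eqn_leq lo // lo'.
rewrite -{x'}xx' in xl' it' xr' E U' *.
have sl : size (inorder l) = size (inorder l').
  have <- : index x (inorder (Node l x r)) = size (inorder l).
    by rewrite /= index_cat (negPf xl) /= eqxx addn0.
  by rewrite E /= index_cat (negPf xl') /= eqxx addn0.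
move: E => /eqP /=; rewrite eqseq_cat // eqseq_cons => /and3P[/eqP El _ /eqP Er].
case/and4P: it => _ _ il ir; case/and4P: it' => _ _ il' ir'.
by rewrite (IHl l') // (IHr r').
Qed.

(** * The pattern 312 and preorder labels *)

Lemma subseq_nth_idx (s w : seq nat) : subseq s w ->
  exists I, [/\ sorted ltn I, all (gtn (size w)) I & s = map (nth 0 w) I].
Proof.
elim: w s => [|y w IH] [|x s] //=; try by exists [::].
have shift I : sorted ltn I -> all (gtn (size w)) I ->
    [/\ sorted ltn (map S I), all (gtn (size w).+1) (map S I)
      & map (nth 0 w) I = map (nth 0 (y :: w)) (map S I)].
  move=> sI aI; split; last by rewrite -map_comp.
    by rewrite sorted_map.
  by rewrite all_map.
case: eqP => [->|_] /IH[I [sI aI ->]]; have [sI' aI' E] := shift I sI aI;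
  last by exists (map S I).
exists (0 :: map S I); split=> //=; last by rewrite -map_comp.
by case: (I) sI'.
Qed.

Lemma subseq_idx_nth (w I : seq nat) : sorted ltn I -> all (gtn (size w)) I ->
  subseq (map (nth 0 w) I) w.
Proof.
move=> sI /allP aI; rewrite -[X in subseq _ X](mkseq_nth 0); apply: map_subseq.
have -> : I = filter (mem I) (iota 0 (size w)).
  apply: (irr_sorted_eq ltn_trans ltnn) => // [|i].
    by apply: sorted_filter (iota_ltn_sorted _ _); apply: ltn_trans.
  rewrite mem_filter mem_iota /=; case: (boolP (i \in I)) => //= /aI.
  by rewrite /= add0n => ->.
exact: filter_subseq.
Qed.

(** Positions are traded for subsequences, which pass directly between a word and its factors. *)
Lemma contains312P w : reflect
  (exists a b c, subseq [:: a; b; c] w /\ b < c < a) (contains312 w).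
Proof.
apply: (iffP existsP) => [[i /existsP[j /existsP[k /andP[/andP[ij jk] H]]]]|].
  exists (nth 0 w i), (nth 0 w j), (nth 0 w k); split=> //.
  apply: (@subseq_idx_nth w [:: val i; val j; val k]) => /=; first by rewrite ij jk.
  by rewrite !ltn_ord.
case=> a [b [c [/subseq_nth_idx[I [sI aI E]] H]]].
case: I E sI aI => [|i [|j [|k [|? ?]]]] // E sI aI.
case: E => Ea Eb Ec; subst a b c; move: sI aI; rewrite /= !andbT => ijk /and3P[hi hj hk].
by exists (Ordinal hi); apply/existsP; exists (Ordinal hj); apply/existsP;
  exists (Ordinal hk); rewrite ijk.
Qed.

(** A label [a] to the left of the root [x] and a smaller label [b] to its right would read [a],
    [x], [b], an occurrence of 312 because [x] is least. So left labels are below right ones, and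
    the preorder word is increasing. *)
Lemma preorder_of_avoiding t n : labeled_tree n t ->
  ~~ contains312 (inorder t) -> preorder t = iota 1 n.
Proof.
case/andP=> P it av.
have U : uniq (inorder t) by rewrite (perm_uniq P) iota_uniq.
apply: (irr_sorted_eq ltn_trans ltnn) => [||i].
- rewrite sorted_pairwise; last exact: ltn_trans.
  elim: t it av U {P} => // l IHl x r IHr it av U.
  have [Ul Ur _ _ lr] := uniq_nodeP U.
  have lt y := @increasing_lt l x r y it.
  have [_ _ il ir] := and4P it.
  have pl := perm_mem (perm_preorder l); have pr := perm_mem (perm_preorder r).
  rewrite /= pairwise_cat IHl ?IHr //.
  + rewrite !andbT; apply/andP; split.
      by apply/allP => y; rewrite mem_cat pl pr => /lt.
    apply/allrelP => a b; rewrite pl pr => al br; rewrite /= ltnNge.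
    apply: contra av => ba; apply/contains312P; exists a, x, b; split.
      apply: (@cat_subseq _ [:: a] [:: x; b]); first by rewrite sub1seq.
      by rewrite /= eqxx sub1seq.
    rewrite lt ?br ?orbT //= ltn_neqAle ba andbT.
    by apply/eqP => E; apply: (lr a); rewrite // -E.
  + apply: contra av => /contains312P[a [b [c [H abc]]]].
    apply/contains312P; exists a, b, c; split=> //; apply: subseq_trans H _.
    by rewrite /= -cat_rcons suffix_subseq.
  apply: contra av => /contains312P[a [b [c [H abc]]]].
  apply/contains312P; exists a, b, c; split=> //; apply: subseq_trans H _.
  by rewrite /= prefix_subseq.
- exact: iota_ltn_sorted.
by rewrite (perm_mem (perm_preorder t)) (perm_mem P).
Qed.

Lemma subseq_cat_split (T : eqType) (s w1 w2 : seq T) : subseq s (w1 ++ w2) ->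
  exists s1 s2, [/\ s = s1 ++ s2, subseq s1 w1 & subseq s2 w2].
Proof.
case/subseqP=> b; rewrite size_cat => sb ->.
have sz : size (take (size w1) b) = size w1 by rewrite size_takel // sb leq_addr.
exists (mask (take (size w1) b) w1), (mask (drop (size w1) b) w2).
by rewrite -{1}(cat_take_drop (size w1) b) mask_cat // !mask_subseq.
Qed.

Lemma preordered_avoids t m k : preorder t = iota m k -> ~~ contains312 (inorder t).
Proof.
elim: t m k => [|l IHl x r IHr] m k E.
  by apply/contains312P => -[a [b [c []]]].
have [p [q [-> _ El Er]]] := preorder_node E.
have inl := preordered_mem El; have inr := preordered_mem Er.
apply/contains312P => -[a [b [c [/subseq_cat_split[s1 [s2 [Es s1l s2r]]] abc]]]].
have nl := IHl _ _ El; have nr := IHr _ _ Er.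
have memr z : z \in s2 -> z = m \/ z \in inorder r.
  by move/(mem_subseq s2r); rewrite inE => /orP[/eqP|]; auto.
have meml z : z \in s1 -> z \in inorder l by apply: mem_subseq.
(* The cases are the number of letters of the occurrence that lie in the left subtree. For 0 or 3
   letters the root cannot take part and induction applies; for 1 or 2 the letters have the wrong
   relative order. *)
case: s1 Es s1l meml => [|a' [|b' [|c' [|? ?]]]] //=.
- move=> Es _ _; rewrite -{}Es /= in s2r; case: eqP s2r => [am|_] H.
    have : b \in inorder r by apply: mem_subseq H _ _; rewrite mem_head.
    by rewrite inr; clear - am abc; lia.
  by case/negP: nr; apply/contains312P; exists a, b, c.
- case=> <- Es _ meml; have := meml a (mem_head _ _); rewrite inl => al.
  have : c \in inorder r.
    rewrite -Es /= in s2r; case: eqP s2r => [_|_] H.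
      by rewrite sub1seq in H.
    by apply: mem_subseq H _ _; rewrite !inE eqxx orbT.
  by rewrite inr; clear - al abc; lia.
- case=> <- <- Es _ meml; have := meml a (mem_head _ _); have := meml b.
  rewrite !inE eqxx orbT inl => /(_ isT) bl; rewrite inl => al.
  by case: (memr c); rewrite -?Es ?mem_head // ?inr; clear - al bl abc; lia.
- by case=> <- <- <- _ s1l _; case/negP: nl; apply/contains312P; exists a, b, c.
Qed.

(** * The isomorphism *)

Lemma block_mem t B : B \in blocks t -> (B != [::]) /\ {subset B <= inorder t}.
Proof.
move=> Bt; split; last first.
  by move=> x xB; rewrite -(perm_mem (perm_blocks t)); apply/flattenP; exists B.
have top u : B \in top_block u -> B != [::].
  by case: u => //= ? ? ?; rewrite inE => /eqP->.
move: Bt; rewrite /blocks mem_cat => /orP[|/top//].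
elim: t => //= l IHl x r IHr; rewrite !mem_cat => /or3P[/IHr//|/IHl//|/top//].
Qed.

Lemma blocks_sorted t m k B : preorder t = iota m k -> B \in blocks t -> sorted ltn B.
Proof.
move=> E; have top u j i : preorder u = iota j i -> B \in top_block u -> sorted ltn B.
  move=> Eu; have := pairwise_sorted (right_chain_sorted Eu).
  by case: u {Eu} => // ? ? ?; rewrite /= inE => ? /eqP->.
rewrite /blocks mem_cat => /orP[|/(top _ _ _ E)//].
elim: t m k E => //= l IHl x r IHr m k /preorder_node[p [q [_ _ El Er]]].
rewrite !mem_cat => /or3P[/(IHr _ _ Er)//|/(IHl _ _ El)//|/(top _ _ _ El)//].
Qed.

Lemma head_mem B : B != [::] -> head 0 B \in B.
Proof. by case: B => // x B _; apply: mem_head. Qed.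

(** The order chosen in [inner_blocks] pays off here: chains inside the right subtree start above
    those of the left subtree, and these start above the root. *)
Lemma blocks_heads t m k : preorder t = iota m k ->
  pairwise (fun B C => head 0 C < head 0 B) (blocks t).
Proof.
elim: t m k => // l IHl x r IHr m k /preorder_node[p [q [-> _ El Er]]].
have pr := IHr _ _ Er; have pl := IHl _ _ El.
have inl B : B \in blocks l -> m < head 0 B < m.+1 + p.
  by move=> /block_mem[/head_mem Bh /(_ _ Bh)]; rewrite (preordered_mem El).
have inr B : B \in inner_blocks r -> m.+1 + p <= head 0 B.
  move=> Br; have : B \in blocks r by rewrite /blocks mem_cat Br.
  by move=> /block_mem[/head_mem Bh /(_ _ Bh)]; rewrite (preordered_mem Er) => /andP[].
have -> : blocks (Node l m r) = (inner_blocks r ++ blocks l) ++ [:: m :: right_chain r] by [].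
rewrite pairwise_cat [pairwise _ (_ ++ blocks l)]pairwise_cat pl andbT.
move: pr; rewrite pairwise_cat => /and3P[_ -> _]; rewrite andbT; apply/andP; split.
  apply/allrelP => B C; rewrite inE => + /eqP-> /=; rewrite mem_cat.
  by case/orP=> [/inr|/inl]; lia.
by rewrite andbT; apply/allrelP => B C /inr + /inl; lia.
Qed.

Lemma same_block_node l x r a b : same_block (blocks (Node l x r)) a b =
  [|| same_block (blocks l) a b, same_block (inner_blocks r) a b
    | (a \in x :: right_chain r) && (b \in x :: right_chain r)].
Proof.
rewrite /same_block /blocks /= !has_cat /= orbF.
by do 3?[case: (has _ _); rewrite /= ?orbT //].
Qed.

Lemma same_block_top t a b : same_block (blocks t) a b =
  same_block (inner_blocks t) a b || (a \in right_chain t) && (b \in right_chain t).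
Proof. by rewrite /same_block has_cat; case: t => //= *; rewrite orbF. Qed.

(** Left labels lie below right ones, so both pairs fall into the same subtree and induction
    applies, unless [a] and [c] are on the chain through the root. *)
Lemma blocks_noncrossing t m k a b c d : preorder t = iota m k ->
    a < b -> b < c -> c < d ->
    same_block (blocks t) a c -> same_block (blocks t) b d ->
  same_block (blocks t) a b.
Proof.
move=> + ab bc cd; elim: t m k a ab => // l IHl x r IHr m k a ab E.
have [p [q [-> _ El Er]]] := preorder_node E.
have inl v w : same_block (blocks l) v w -> m < v < m.+1 + p /\ m < w < m.+1 + p.
  by move/same_block_mem; rewrite !mem_blocks !(preordered_mem El) => /andP[].
have inr v w : same_block (blocks r) v w ->
    m.+1 + p <= v < m.+1 + p + q /\ m.+1 + p <= w < m.+1 + p + q.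
  by move/same_block_mem; rewrite !mem_blocks !(preordered_mem Er) => /andP[].
have inc v : v \in right_chain r -> m.+1 + p <= v < m.+1 + p + q.
  by move/right_chain_mem; rewrite (preordered_mem Er).
have bdr : m < b -> same_block (inner_blocks r) b d
      || (b \in m :: right_chain r) && (d \in m :: right_chain r) ->
    same_block (blocks r) b d.
  move=> mb; rewrite same_block_top !inE (gtn_eqF mb).
  by rewrite (gtn_eqF (ltn_trans mb (ltn_trans bc cd))).
have lift v w : same_block (blocks r) v w ->
    same_block (blocks (Node l m r)) v w.
  by rewrite same_block_node same_block_top !inE => /orP[->|/andP[-> ->]]; rewrite !orbT.
rewrite {1}same_block_node => /or3P[ac|ac|].
- have [al cl] := inl _ _ ac.
  have mb : m < b by case/andP: al => ? _; apply: ltn_trans ab.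
  rewrite same_block_node => /orP[bd|/(bdr mb) /inr[br _]].
    by rewrite same_block_node (IHl _ _ _ ab El ac bd).
  by clear - br cl bc; lia.
- have {}ac : same_block (blocks r) a c by rewrite same_block_top ac.
  have [ar cr] := inr _ _ ac.
  have mb : m < b by clear - ar ab; lia.
  rewrite same_block_node => /orP[/inl[_ dl]|/(bdr mb) bd].
    by clear - dl cr cd; lia.
  by apply: lift; apply: (IHr _ _ _ ab Er ac).
rewrite !inE => /andP[ar cr].
have ma : m <= a.
  by case/orP: ar => [/eqP->//|/inc]; clear; lia.
have mb := leq_ltn_trans ma ab.
have {}cr : c \in right_chain r.
  by move: cr; rewrite (gtn_eqF (ltn_trans mb bc)).
have cr' := inc _ cr.
rewrite same_block_node => /orP[/inl[_ dl]|/(bdr mb) bd].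
  by clear - dl cr' cd; lia.
case/orP: ar => [/eqP Ea|ar]; last first.
  by apply: lift; apply: (IHr _ _ _ ab Er) => //; rewrite same_block_top ar cr orbT.
(* Here [a] is the root. The root [z] of [r] replaces it in the induction: it lies on the same chain
   and is the least label of [r]. *)
have [br _] := inr _ _ bd.
case Er' : r cr => [//|lr z rr] cr; rewrite -Er' in cr.
have zE : z = m.+1 + p by apply: (preordered_root Er); rewrite Er'.
have zr : z \in right_chain r by rewrite Er' mem_head.
suff br' : b \in right_chain r.
  by rewrite -Er' same_block_node Ea !inE eqxx br' !orbT.
case: (ltngtP z b) => [zb|bz|<-//]; last by clear - bz zE br; lia.
have : same_block (blocks r) z b.
  by apply: (IHr _ _ _ zb Er) => //; rewrite same_block_top zr cr orbT.
case/same_blockP=> B [Br zB bB].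
have rr' : right_chain r \in blocks r by rewrite /blocks mem_cat Er' /= mem_head orbT.
by rewrite (uniq_flatten_block _ rr' Br zr zB) // uniq_blocks (preordered_uniq Er).
Qed.

Lemma blocks_ncp n t : preorder t = iota 1 n ->
  [/\ is_nccp n (blocks t), noncrossing (blocks t) & canonical (blocks t)].
Proof.
move=> E; have heads := blocks_heads E.
have U : uniq (flatten (blocks t)) by rewrite uniq_blocks (preordered_uniq E).
have bs B : B \in blocks t -> (B != [::]) && sorted ltn B.
  by move=> Bt; have [-> _] := block_mem Bt; rewrite (blocks_sorted E).
have can : canonical (blocks t).
  apply: pairwise_sorted; apply: (sub_in_pairwise (P := mem (blocks t))) heads.
    move=> B C Bt Ct; have /andP[_ sB] := bs B Bt; have /andP[_ sC] := bs C Ct.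
    by rewrite !block_min_sorted.
  by apply/allP.
split=> //.
  apply/and3P; split.
  - exact: perm_trans (perm_blocks t) (preordered_perm E).
  - exact/allP.
  (* Decreasing minima already give the descents, since the minimum of a block is at most its
     maximum. *)
  apply: (sub_in_sorted (P := mem (blocks t))) can; last exact/allP.
  move=> B C Bt Ct; have /andP[_ sB] := bs B Bt.
  by rewrite (block_min_sorted sB) => /leq_trans; apply; apply: head_le_block_max.
apply/forallP => i; apply/forallP => j; apply/implyP => ij.
apply/negP => /hasP[a ai /hasP[b bj /hasP[c ci /hasP[d dj /and3P[ab bc cd]]]]].
have it : nth [::] (blocks t) i \in blocks t by rewrite mem_nth.
have jt : nth [::] (blocks t) j \in blocks t by rewrite mem_nth.
have : same_block (blocks t) a b.
  apply: (blocks_noncrossing E ab bc cd).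
    by apply/same_blockP; exists (nth [::] (blocks t) i).
  by apply/same_blockP; exists (nth [::] (blocks t) j).
case/same_blockP=> B [Bt aB bB]; case/negP: ij; apply/eqP/val_inj/eqP.
(* Strictly decreasing first entries make the blocks distinct, so equal blocks have equal
   positions. *)
have nodup : uniq (blocks t).
  by apply: pairwise_uniq heads => B' /=; rewrite ltnn.
rewrite -(nth_uniq [::] (ltn_ord i) (ltn_ord j) nodup).
by rewrite (uniq_flatten_block U it Bt ai aB) (uniq_flatten_block U jt Bt bj bB).
Qed.

(** Brings the condition on positions of blocks into the relational shape required of [E]. *)
Lemma noncrossing_same_block n pi a b c d : is_nccp n pi -> noncrossing pi ->
    a < b -> b < c -> c < d -> same_block pi a c -> same_block pi b d ->
  same_block pi a b.
Proof.
move=> H nc ab bc cd /same_blockP[B [Bpi aB cB]] /same_blockP[C [Cpi bC dC]].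
apply/same_blockP; exists B; split=> //.
have iB : index B pi < size pi by rewrite index_mem.
have iC : index C pi < size pi by rewrite index_mem.
have /forallP/(_ (Ordinal iC)) := forallP nc (Ordinal iB).
rewrite !nth_index //; case: eqVneq => [E|_ /= /negP[]].
  have /= := congr1 val E => EI _.
  by rewrite -(nth_index [::] Bpi) EI nth_index.
by apply/hasP; exists a => //; apply/hasP; exists b => //; apply/hasP; exists c => //;
  apply/hasP; exists d; rewrite // ab bc.
Qed.

(** * Preordered trees are determined by their blocks *)

Lemma preordered_inj t t' m k : preorder t = iota m k -> preorder t' = iota m k ->
  redges t =i redges t' -> t = t'.
Proof.
elim: t t' m k => [|l IHl x r IHr] [|l' x' r'] m k E E' He //.
- by move: E E' => <-.
- by move: E' E => <-.
have [p [q [Ex Ek El Er]]] := preorder_node E.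
have [p' [q' [Ex' Ek' El' Er']]] := preorder_node E'.
rewrite {}Ex {}Ex' in E E' He *.
have root u v i j z : preorder u = iota m.+1 i -> preorder v = iota (m.+1 + i) j ->
    (m, z) \in redges (Node u m v) <-> root_label v = Some z.
  move=> Eu Ev; rewrite /= !mem_cat; split=> [/or3P[|/right_edges_atP[]//|]|vz].
  - by case/redges_mem; rewrite (preordered_mem Eu) ltnn.
  - by case/redges_mem; rewrite (preordered_mem Ev) => H; clear - H; lia.
  by rewrite mem_right_edges ?orbT.
have rr : root_label r = root_label r'.
  case Ez : (root_label r) => [z|].
    by apply/esym/(root _ _ _ _ _ El' Er'); rewrite -He; apply/(root _ _ _ _ _ El Er).
  case Ez' : (root_label r') => [z|] //; rewrite -Ez; apply/(root _ _ _ _ _ El Er).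
  by rewrite He; apply/(root _ _ _ _ _ El' Er').
(* The right child of the root is labeled [m.+1 + p], which reveals the size [p] of the left
   subtree; without a right child, the left subtree has all the remaining labels. *)
have pp : p = p'.
  have qr u i j : preorder u = iota i j -> root_label u = None -> j = 0.
    by case: u => // /(congr1 size); rewrite size_iota.
  case Ez : (root_label r) => [z|]; rewrite Ez in rr.
    have := preordered_root Er Ez; have := preordered_root Er' (esym rr).
    by clear; lia.
  have := qr _ _ _ Er Ez; have := qr _ _ _ Er' (esym rr).
  by clear - Ek Ek'; lia.
have qq : q = q' by clear - pp Ek Ek'; lia.
rewrite -{p'}pp -{q'}qq in El' Er' Ek'.
have inl y : (y \in inorder l) = (m < y < m.+1 + p) by rewrite (preordered_mem El).
have inl' y : (y \in inorder l') = (m < y < m.+1 + p) by rewrite (preordered_mem El').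
have inr y : (y \in inorder r) = (m.+1 + p <= y < m.+1 + p + q).
  by rewrite (preordered_mem Er).
have inr' y : (y \in inorder r') = (m.+1 + p <= y < m.+1 + p + q).
  by rewrite (preordered_mem Er').
have left u v y z : preorder u = iota m.+1 p -> preorder v = iota (m.+1 + p) q ->
    ((y, z) \in redges u) = ((y, z) \in redges (Node u m v)) && (m < y < m.+1 + p).
  move=> Eu Ev; have U : uniq (inorder (Node u m v)).
    apply: (@preordered_uniq _ m (p + q).+1).
    by rewrite /= Eu Ev iotaD.
  rewrite [redges (Node _ _ _)]/= !mem_cat.
  case: (boolP (_ \in redges u)) => [/redges_mem[]|_]; first by rewrite (preordered_mem Eu).
  apply/esym/negP => /= /andP[/orP[/right_edges_atP[-> _]|/redges_mem[]]].
    by rewrite ltnn.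
  by rewrite (preordered_mem Ev) => H _ H'; clear - H H'; lia.
have right u v y z : preorder u = iota m.+1 p -> preorder v = iota (m.+1 + p) q ->
    ((y, z) \in redges v) = ((y, z) \in redges (Node u m v)) && (m.+1 + p <= y).
  move=> Eu Ev; rewrite [redges (Node _ _ _)]/= !mem_cat.
  case: (boolP (_ \in redges v)) => [/redges_mem[]|_].
    by rewrite (preordered_mem Ev) => /andP[-> _]; rewrite !orbT.
  rewrite orbF; apply/esym/negP => /andP[/orP[/redges_mem[]|/right_edges_atP[-> _]]].
    by rewrite (preordered_mem Eu) => H _ H'; clear - H H'; lia.
  by clear; lia.
congr Node.
  apply: (IHl _ _ _ El El') => -[y z].
  by rewrite (left _ r _ _ El Er) (left _ r' _ _ El' Er') He.
apply: (IHr _ _ _ Er Er') => -[y z].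
by rewrite (right l _ _ _ El Er) (right l' _ _ _ El' Er') He.
Qed.

Lemma blocks_inj n t t' : preorder t = iota 1 n -> preorder t' = iota 1 n ->
  blocks t = blocks t' -> t = t'.
Proof.
move=> E E' B; apply: preordered_inj E E' _ => e.
by rewrite !mem_redges_blocks B.
Qed.

(** The last two clauses bound the blocks of [t] by [E] from both sides in a way that leaves room
    for labels not related to themselves. *)
Lemma tree_of_equivalence n (E : rel nat) : symmetric E -> transitive E ->
    (forall a b c d, a < b -> b < c -> c < d -> E a c -> E b d -> E a b) ->
  exists t, [/\ preorder t = iota 1 n,
    forall x y, 0 < x <= n -> 0 < y <= n -> E x y -> same_block (blocks t) x y
  & forall pi, is_nccp n pi -> (forall x y, E x y -> same_block pi x y) ->
      forall x y, same_block (blocks t) x y -> same_block pi x y].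
Proof.
move=> symE transE ncE; set t0 := link_left (fun=> Empty) (iota 1 n).
have E0 : preorder t0 = iota 1 n.
  by rewrite /t0; elim: (iota 1 n) => //= x s ->; rewrite cats0.
(* The starting tree is a left comb: it has no right edge, so it is compatible with every
   relation. *)
have c0 : compatible E t0.
  move=> x y; rewrite redges_link_left => /flattenP[_ /mapP[z _ ->]].
  by [].
have [t [_ Et ct Ht]] := rotate_to_equivalence symE transE ncE E0 c0.
exists t; split=> // [x y hx hy|pi H sub x y].
  by apply: Ht; rewrite (preordered_mem Et) add1n ltnS.
apply: same_block_blocks_sub => [|z|a b ab]; first exact: nccp_uniq H.
  by rewrite (preordered_mem Et) (nccp_mem H) add1n ltnS.
exact/sub/ct.
Qed.

(** Stated on all of [NCCP n], because a chain of rotations may pass through words containing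
    312. *)
Lemma le_NCCP_same_block n (x y : NCCP n) : le_NCCP x y -> forall a b,
  same_block (blocks (tree_of_word (word x))) a b ->
  same_block (blocks (tree_of_word (word y))) a b.
Proof.
elim=> {x y} [x y [L [L' [lL lL' EL EL' rot]]]|//|x y z _ xy _ yz] a b; last first.
  by move/xy/yz.
have tree (u : NCCP n) t : labeled_tree n t -> inorder t = word u ->
    t = tree_of_word (word u).
  case/andP=> P it Ew; have U : uniq (word u) by rewrite -Ew (perm_uniq P) iota_uniq.
  apply: increasing_inj => //; rewrite ?Ew ?inorder_tree_of_word //.
  exact: increasing_tree_of_word.
by rewrite -(tree x L) // -(tree y L') //; exact: rotation_same_block lL lL' rot.
Qed.

Lemma tree_steps_le n t t' : clos_refl_trans _ (tree_step n) t t' ->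
  forall x y : NCCP n, word x = inorder t -> word y = inorder t' -> le_NCCP x y.
Proof.
move/(clos_rt_rt1n _ _ _ _); elim=> {t t'} [t|t u t' [Et Eu rot] _ IH] x y Ex Ey.
  have -> : x = y by apply: word_inj; rewrite Ex.
  exact: rt_refl.
have Pu := preordered_perm Eu.
apply: rt_trans (IH (nccp_of_word Pu) y _ Ey); last exact: word_nccp_of_word.
apply: rt_step; exists t, u; split; rewrite ?word_nccp_of_word //;
  exact: preordered_labeled.
Qed.

Section Isomorphism.

Variable n : nat.

Lemma preorder_tree_of_word312 (x : NCCP312 n) :
  preorder (tree_of_word (word (sval x))) = iota 1 n.
Proof.
case: x => x av /=; apply: preorder_of_avoiding; rewrite ?inorder_tree_of_word //.
rewrite /labeled_tree inorder_tree_of_word word_perm.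
by rewrite increasing_tree_of_word // (perm_uniq (word_perm x)) iota_uniq.
Qed.

Definition ncp_of_tree t (Et : preorder t = iota 1 n) : NCP n :=
  let: And3 H nc can := blocks_ncp Et in
  exist _ (exist _ (blocks t) H) (introT andP (conj nc can)).

Lemma sval_ncp_of_tree t (Et : preorder t = iota 1 n) :
  sval (sval (ncp_of_tree Et)) = blocks t.
Proof. by rewrite /ncp_of_tree; case: (blocks_ncp Et). Qed.

Definition nccp312_of_tree t (Et : preorder t = iota 1 n) : NCCP312 n.
Proof.
exists (nccp_of_word (preordered_perm Et)).
by rewrite word_nccp_of_word (preordered_avoids Et).
Defined.

Lemma word_nccp312_of_tree t (Et : preorder t = iota 1 n) :
  word (sval (nccp312_of_tree Et)) = inorder t.
Proof. exact: word_nccp_of_word. Qed.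

Lemma tree_of_nccp312_of_tree t (Et : preorder t = iota 1 n) :
  tree_of_word (word (sval (nccp312_of_tree Et))) = t.
Proof.
rewrite word_nccp312_of_tree; have U := preordered_uniq Et.
apply: increasing_inj; rewrite ?inorder_tree_of_word //.
  exact: increasing_tree_of_word.
exact: preordered_increasing Et.
Qed.

Definition chain_partition (x : NCCP312 n) : NCP n :=
  ncp_of_tree (preorder_tree_of_word312 x).

(** * The Kreweras order as inclusion of relations, and its lattice structure *)

Definition ncp_rel (p : NCP n) : rel nat := same_block (sval (sval p)).

Lemma ncp_rel_trans p : transitive (ncp_rel p).
Proof. by move=> y x z; apply: same_block_trans (nccp_uniq (svalP (sval p))). Qed.

Lemma ncp_rel_nc p a b c d : a < b -> b < c -> c < d ->
  ncp_rel p a c -> ncp_rel p b d -> ncp_rel p a b.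
Proof.
case: p => [[pi H] /= nc]; have /andP[ncpi _] := nc.
exact: noncrossing_same_block H ncpi.
Qed.

Lemma ncp_rel_dom p a b : ncp_rel p a b -> (0 < a <= n) /\ (0 < b <= n).
Proof.
by move/same_block_mem; rewrite !(nccp_mem (svalP (sval p))) => /andP[].
Qed.

Lemma le_NCP_relP (p q : NCP n) :
  le_NCP p q <-> forall a b, ncp_rel p a b -> ncp_rel q a b.
Proof. exact: refines_nccp (svalP (sval p)) (svalP (sval q)). Qed.

Lemma ncp_inj (p q : NCP n) : (forall a b, ncp_rel p a b <-> ncp_rel q a b) -> p = q.
Proof.
case: p q => [[pi H] c] [[pi' H'] c'] eqr; apply/val_inj/val_inj => /=.
have /andP[_ cpi] := c; have /andP[_ cpi'] := c'.
exact: same_block_inj H H' cpi cpi' eqr.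
Qed.

Lemma le_NCP_partial_order : partial_order (@le_NCP n).
Proof.
split=> [p|p q /le_NCP_relP pq /le_NCP_relP qp|p q r /le_NCP_relP pq /le_NCP_relP qr].
- exact/le_NCP_relP.
- by apply: ncp_inj => a b; split; [apply: pq|apply: qp].
- by apply/le_NCP_relP => a b /pq/qr.
Qed.

(** The two clauses are the comparisons that meets and joins call for: [p] is above whatever is
    contained in [E] and below whatever contains [E]. *)
Lemma ncp_of_equivalence (E : rel nat) : symmetric E -> transitive E ->
    (forall a b c d, a < b -> b < c -> c < d -> E a c -> E b d -> E a b) ->
  exists p : NCP n,
    (forall q, (forall a b, ncp_rel q a b -> E a b) -> le_NCP q p) /\
    (forall q, (forall a b, E a b -> ncp_rel q a b) -> le_NCP p q).
Proof.
move=> symE transE ncE; have [t [Et H1 H2]] := tree_of_equivalence n symE transE ncE.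
exists (ncp_of_tree Et); split=> q H; apply/le_NCP_relP => a b.
  move=> qab; have [ha hb] := ncp_rel_dom qab.
  by rewrite /ncp_rel sval_ncp_of_tree; apply: H1 (H _ _ qab).
rewrite {1}/ncp_rel sval_ncp_of_tree; apply: H2 => //.
exact: svalP (sval q).
Qed.

Lemma ncp_meet (p q : NCP n) : exists m, is_meet (@le_NCP n) p q m.
Proof.
have [|b a c|a b c d ab bc cd|m [lo up]] :=
  @ncp_of_equivalence (fun a b => ncp_rel p a b && ncp_rel q a b).
- by move=> a b; rewrite /ncp_rel ![same_block _ a b]same_block_sym.
- move=> /andP[pab qab] /andP[pbc qbc].
  by rewrite (ncp_rel_trans pab pbc) (ncp_rel_trans qab qbc).
- move=> /andP[pac qac] /andP[pbd qbd].
  by rewrite (ncp_rel_nc ab bc cd pac pbd) (ncp_rel_nc ab bc cd qac qbd).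
exists m; split; [by apply: up => a b /andP[]|by apply: up => a b /andP[]|].
by move=> r /le_NCP_relP rp /le_NCP_relP rq; apply: lo => a b rab; rewrite rp ?rq.
Qed.

(** The union of the two relations may be neither transitive nor noncrossing, whereas the
    intersection of all upper bounds inherits both properties. *)
Lemma ncp_join (p q : NCP n) : exists j, is_join (@le_NCP n) p q j.
Proof.
pose P a b := forall r, le_NCP p r -> le_NCP q r -> ncp_rel r a b.
(* Excluded middle turns the quantification over all upper bounds into a boolean relation. *)
pose E a b := if excluded_middle_informative (P a b) then true else false.
have EP a b : reflect (P a b) (E a b).
  by rewrite /E; case: excluded_middle_informative => H; constructor.
have [|b a c|a b c d ab bc cd|j [lo up]] := @ncp_of_equivalence E.
- move=> a b; apply/EP/EP => H r pr qr; rewrite /ncp_rel same_block_sym; exact: H.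
- move=> /EP ab /EP bc; apply/EP => r pr qr.
  exact: ncp_rel_trans (ab _ pr qr) (bc _ pr qr).
- move=> /EP ac /EP bd; apply/EP => r pr qr.
  exact: ncp_rel_nc ab bc cd (ac _ pr qr) (bd _ pr qr).
exists j; split.
- by apply: lo => a b pab; apply/EP => r /le_NCP_relP pr _; apply: pr.
- by apply: lo => a b qab; apply/EP => r _ /le_NCP_relP qr; apply: qr.
- by move=> r pr qr; apply: up => a b /EP; apply.
Qed.

Lemma le_NCP_lattice : lattice_order (@le_NCP n).
Proof.
split; first exact: le_NCP_partial_order.
by move=> p q; split; [apply: ncp_meet|apply: ncp_join].
Qed.

(** Forward, this is the monotonicity of rotations. Backward, the tree of [x] is rotated towards the
    blocks of the tree of [y], and the tree reached is that of [y]. *)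
Lemma le_chain_partition (x y : NCCP312 n) :
  le_NCCP312 x y <-> le_NCP (chain_partition x) (chain_partition y).
Proof.
rewrite le_NCP_relP /ncp_rel !sval_ncp_of_tree; split=> [|sub].
  exact: le_NCCP_same_block.
have Ex := preorder_tree_of_word312 x; have Ey := preorder_tree_of_word312 y.
have Cx := inorder_tree_of_word (word (sval x)).
have Cy := inorder_tree_of_word (word (sval y)).
rewrite /le_NCCP312.
move: (tree_of_word (word (sval x))) (tree_of_word (word (sval y))) sub Ex Ey Cx Cy.
move=> tx ty sub Ex Ey Cx Cy.
have [H nc can] := blocks_ncp Ey.
have transE : transitive (same_block (blocks ty)).
  by move=> b a c; apply: same_block_trans (nccp_uniq H).
have comp : compatible (same_block (blocks ty)) tx.
  by move=> a b /redges_same_block/sub.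
have [t [T Et ct Ht]] := rotate_to_equivalence (same_block_sym _) transE
  (fun a b c d => noncrossing_same_block H nc) Ex comp.
(* Equality of the two block relations is enough, since canonical blocks are determined by their
   relation and preordered trees by their blocks. *)
suff Ety : t = ty by apply: tree_steps_le T _ _ (esym Cx) _; rewrite Ety.
apply: (blocks_inj Et Ey); have [H' _ can'] := blocks_ncp Et.
apply: (same_block_inj H' H can' can) => a b; split=> [|ab].
  apply: same_block_blocks_sub ct; first exact: nccp_uniq H.
  by move=> z; rewrite mem_blocks (preordered_mem Et) (preordered_mem Ey).
have := same_block_mem ab; rewrite !mem_blocks !(preordered_mem Ey) => /andP[ha hb].
by apply: Ht; rewrite ?(preordered_mem Et).
Qed.

Lemma chain_partition_bij : bijective chain_partition.
Proof.
have inj : injective chain_partition.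
  move=> x y /(congr1 (fun p => sval (sval p))); rewrite !sval_ncp_of_tree => eqb.
  apply/val_inj/word_inj; rewrite -[LHS]inorder_tree_of_word -[RHS]inorder_tree_of_word.
  by congr inorder; apply: blocks_inj eqb; apply: preorder_tree_of_word312.
have surj p : exists x : NCCP312 n, chain_partition x = p.
  have [t [Et H1 H2]] := @tree_of_equivalence n (ncp_rel p)
    (same_block_sym _) (@ncp_rel_trans p) (@ncp_rel_nc p).
  exists (nccp312_of_tree Et); apply: ncp_inj => a b.
  rewrite /ncp_rel sval_ncp_of_tree tree_of_nccp312_of_tree; split.
    by apply: H2 => //; apply: svalP (sval p).
  by move=> pab; have [ha hb] := ncp_rel_dom pab; apply: H1.
(* Surjectivity gives mere existence, so the inverse map is obtained by choosing preimages. *)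
pose g p := sval (constructive_indefinite_description _ (surj p)).
have gK : cancel g chain_partition.
  by move=> p; apply: svalP (constructive_indefinite_description _ (surj p)).
by exists g => // x; apply: inj; rewrite gK.
Qed.

End Isomorphism.

Lemma lattice_order_iso (T U : Type) (leT : T -> T -> Prop) (leU : U -> U -> Prop)
    (f : T -> U) : bijective f -> (forall x y : T, leT x y <-> leU (f x) (f y)) ->
  lattice_order leU -> lattice_order leT.
Proof.
case=> g fK gK mono [[refl anti trans] mj]; split.
  split=> [x|x y /mono xy /mono yx|x y z /mono xy /mono yz].
  - exact/mono.
  - by rewrite -(fK x) -(fK y) (anti _ _ xy yx).
  - exact/mono/(trans _ _ _ xy yz).
(* The inverse map is adjoint to [f] on both sides, so greatest lower and least upper bounds are
   carried back by [g]. *)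
have monog (a : T) (b : U) : leT a (g b) <-> leU (f a) b by rewrite mono gK.
have monog' (a : T) (b : U) : leT (g b) a <-> leU b (f a) by rewrite mono gK.
move=> x y; have [[m [mx my mlub]] [j [xj yj jlub]]] := mj (f x) (f y); split.
  exists (g m); split; [exact/monog'|exact/monog'|].
  by move=> z /mono zx /mono zy; apply/monog/mlub.
exists (g j); split; [exact/monog|exact/monog|].
by move=> z /mono xz /mono yz; apply/monog'/jlub.
Qed.

Theorem proposition3p25 (n : nat) (n_ge1 : 1 <= n) :
  [/\ lattice_order (@le_NCCP312 n),
      lattice_order (@le_NCP n)
    & order_isomorphic (@le_NCCP312 n) (@le_NCP n)].
Proof.
have lat := le_NCP_lattice n; have bij := chain_partition_bij n.
have mono := @le_chain_partition n; split=> //.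
  exact: lattice_order_iso bij mono lat.
by exists (@chain_partition n).
Qed.
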